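(* For every smooth function $\Psi:\mathbf R^2\to\mathbf R$ and every $h>0$, there exists a complete immersed helicoidal surface of pitch $h$ satisfying the equation $H=\Psi(\tau,\nu)$.
   Context: Identify $\mathbf R^2$ with $\mathbf C$. For $h>0$ and an immersed curve $X:\mathbf R\to\mathbf R^2$ parametrized by arc length $s$, the helicoidal surface of pitch $h$ (with axis the $z$-axis) generated by $X$ is the immersed surface in $\mathbf R^3$ parametrized by $F(s,t)=(e^{it}X(s),ht)$, $s,t\in\mathbf R$; it is invariant under the helicoidal motions $(x,y,z)\mapsto(x\cos t-y\sin t,\,x\sin t+y\cos t,\,z+ht)$. Put $T=\frac{dX}{ds}$, $N=iT$, $\tau=\langle X,T\rangle$, $\nu=\langle X,N\rangle$. The unit normal of the surface is $\mathbf n=\frac{(he^{it}N,-\tau)}{\sqrt{\tau^2+h^2}}$, and the mean curvature $H=\operatorname{div}\mathbf n$ is taken with respect to this normal. The equation $H=\Psi(\tau,\nu)$ means that at the point $F(s,t)$ the mean curvature equals $\Psi(\tau(s),\nu(s))$. *)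

(* Defs.v *)
From Stdlib Require Import Reals.
From Coquelicot Require Import Coquelicot.
Open Scope R_scope.

(* ** Smoothness *)

Fixpoint class_C (k : nat) (f : R -> R -> R) : Prop :=
  match k with
  | O => forall x y, continuity_2d_pt f x y
  | S k' =>
      (forall x y, ex_derive (fun u => f u y) x /\ ex_derive (fun v => f x v) y)
      /\ class_C k' (fun x y => Derive (fun u => f u y) x)
      /\ class_C k' (fun x y => Derive (fun v => f x v) y)
  end.

Definition smooth2 (f : R -> R -> R) : Prop := forall k, class_C k f.

Definition smooth1 (f : R -> R) : Prop := forall k x, ex_derive_n f k x.

(* ** Euclidean structure on R^2 = C and on R^3 = C x R *)

Definition dotC (z w : C) : R := Re z * Re w + Im z * Im w.

Definition R3 : Type := (C * R)%type.

Definition dot3 (p q : R3) : R := dotC (fst p) (fst q) + snd p * snd q.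

Definition expi (t : R) : C := (cos t, sin t).

Definition DeriveC (f : R -> C) (x : R) : C :=
  (Derive (fun u => Re (f u)) x, Derive (fun u => Im (f u)) x).

Definition Derive3 (f : R -> R3) (x : R) : R3 :=
  (DeriveC (fun u => fst (f u)) x, Derive (fun u => snd (f u)) x).

(* ** Parametrized surfaces in R^3, with parameter domain the whole plane *)

Definition d_s (V : R -> R -> R3) (s t : R) : R3 := Derive3 (fun u => V u t) s.
Definition d_t (V : R -> R -> R3) (s t : R) : R3 := Derive3 (fun v => V s v) t.

Definition smooth_map (V : R -> R -> R3) : Prop :=
  smooth2 (fun s t => Re (fst (V s t)))
  /\ smooth2 (fun s t => Im (fst (V s t)))
  /\ smooth2 (fun s t => snd (V s t)).

Definition lincomb (a : R) (p : R3) (b : R) (q : R3) : R3 :=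
  ((RtoC a * fst p + RtoC b * fst q)%C, a * snd p + b * snd q).

Definition immersion (F : R -> R -> R3) : Prop :=
  smooth_map F
  /\ forall s t a b : R,
       lincomb a (d_s F s t) b (d_t F s t) = (RtoC 0, 0) -> a = 0 /\ b = 0.

Definition g_ss (F : R -> R -> R3) (s t : R) : R := dot3 (d_s F s t) (d_s F s t).
Definition g_st (F : R -> R -> R3) (s t : R) : R := dot3 (d_s F s t) (d_t F s t).
Definition g_tt (F : R -> R -> R3) (s t : R) : R := dot3 (d_t F s t) (d_t F s t).

(* Divergence along the surface, [sum_ij g^ij <d_i V, d_j F>], the inverse
   metric [g^ij] being written out. *)
Definition surface_div (F V : R -> R -> R3) (s t : R) : R :=
  (g_tt F s t * dot3 (d_s V s t) (d_s F s t)
   - g_st F s t * (dot3 (d_s V s t) (d_t F s t) + dot3 (d_t V s t) (d_s F s t))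
   + g_ss F s t * dot3 (d_t V s t) (d_t F s t))
  / (g_ss F s t * g_tt F s t - g_st F s t * g_st F s t).

(* ** Completeness of the induced Riemannian metric *)

Definition C1_fun (a : R -> R) : Prop :=
  forall u, ex_derive a u /\ continuous (Derive a) u.

Definition path_length (F : R -> R -> R3) (a b : R -> R) : R :=
  RInt (fun u => sqrt (g_ss F (a u) (b u) * (Derive a u) ^ 2
                       + 2 * g_st F (a u) (b u) * Derive a u * Derive b u
                       + g_tt F (a u) (b u) * (Derive b u) ^ 2)) 0 1.

(* Paths may stop (zero velocity), so piecewise C1 paths, reparametrized, give
   the same set of lengths; and a C1 path on [0,1] extends to a C1 path on R. *)
Definition path_lengths (F : R -> R -> R3) (p q : R * R) (l : R) : Prop :=
  exists a b : R -> R,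
    C1_fun a /\ C1_fun b
    /\ (a 0, b 0) = p /\ (a 1, b 1) = q
    /\ l = path_length F a b.

Definition intrinsic_dist (F : R -> R -> R3) (p q : R * R) : Rbar :=
  Glb_Rbar (path_lengths F p q).

Definition complete_surface (F : R -> R -> R3) : Prop :=
  forall p : nat -> R * R,
    (forall eps : posreal, exists n0 : nat, forall m n : nat,
       (n0 <= m)%nat -> (n0 <= n)%nat ->
       Rbar_lt (intrinsic_dist F (p m) (p n)) eps) ->
    exists q : R * R,
      forall eps : posreal, exists n0 : nat, forall n : nat,
        (n0 <= n)%nat -> Rbar_lt (intrinsic_dist F (p n) q) eps.

(* ** Helicoidal surfaces *)

Definition smooth_curve (X : R -> C) : Prop :=
  smooth1 (fun s => Re (X s)) /\ smooth1 (fun s => Im (X s)).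

Definition tangent (X : R -> C) (s : R) : C := DeriveC X s.
Definition normal (X : R -> C) (s : R) : C := (Ci * tangent X s)%C.
Definition tau (X : R -> C) (s : R) : R := dotC (X s) (tangent X s).
Definition nu (X : R -> C) (s : R) : R := dotC (X s) (normal X s).

Definition arclength_curve (X : R -> C) : Prop :=
  smooth_curve X /\ forall s, Cmod (tangent X s) = 1.

Definition helicoidal_surface (h : R) (X : R -> C) (s t : R) : R3 :=
  ((expi t * X s)%C, h * t).

Definition unit_normal (h : R) (X : R -> C) (s t : R) : R3 :=
  let w := sqrt (tau X s ^ 2 + h ^ 2) in
  ((RtoC (h / w)%R * (expi t * normal X s))%C, - tau X s / w).

Definition mean_curvature (h : R) (X : R -> C) (s t : R) : R :=
  surface_div (helicoidal_surface h X) (unit_normal h X) s t.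

(* Main.v *)
Require Import Defs.
From Stdlib Require Import Reals.
From Coquelicot Require Import Coquelicot.
From Stdlib Require Import Lra Lia FunctionalExtensionality.
Open Scope R_scope.

(** Let theta be the angle of the tangent, so that X' = exp(i theta), and let
k = theta' be the curvature of the generating curve.  The first fundamental
form of the helicoidal surface is ds^2 - 2 nu ds dt + (tau^2 + nu^2 + h^2) dt^2
with determinant w^2 = tau^2 + h^2, and its mean curvature is
  H = - h (k (w^2 + nu^2) + nu) / w^3
(lemma [helicoidal_mean_curvature]).  The coefficient of k never vanishes, so
H = Psi(tau, nu) can be solved for k: it says k = kap(tau, nu) for the smooth
function [curvature_for_H].

It remains to find a curve, defined for all s, with k = kap(tau, nu).  The
vector field (tau, nu) |-> (1 + kap nu, - kap tau) may grow arbitrarily fast,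
which would leave the lifetime of a solution to an a priori estimate.  Taking
theta as the only unknown builds the estimate in: X is recovered as the
integral of exp(i theta) from 0, so |X(s)| <= |s| whatever theta is, tau and nu
are bounded on every bounded interval by a constant independent of theta, and
theta' = kap(tau, nu) is an equation with a causal right-hand side that is
Lipschitz on every bounded interval.  Picard iteration then converges on the
whole line ([causal_ode_global_solution]), and smoothness follows by
bootstrapping ([unit_speed_frame_smooth]).

Completeness is seen by comparison with the coordinates h arcsinh(s/h) and h t:
the metric dominates the square of the differential of each of them, thanks to
|X(s)| <= |s|, and they map the parameter plane homeomorphically onto the
Euclidean plane.  Hence a Cauchy sequence for the intrinsic distance converges
in these coordinates, and straight segments in the (s,t)-plane show that it
then converges for the intrinsic distance ([helicoidal_complete]). *)

(** * Global solutions of causal differential equations *)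

Lemma is_derive_continuity_pt (F : R -> R) x l : is_derive F x l -> continuity_pt F x.
Proof.
  intros H. apply continuity_pt_filterlim.
  apply (ex_derive_continuous F). now exists l.
Qed.

Lemma nondecreasing_of_nonneg_derivative (F f : R -> R) (a b : R) :
  a <= b ->
  (forall x, a <= x <= b -> is_derive F x (f x)) ->
  (forall x, a <= x <= b -> 0 <= f x) ->
  F a <= F b.
Proof.
  intros Hab HF Hf.
  destruct (MVT_gen F a b f) as [c [Hc E]];
    rewrite Rmin_left, Rmax_right in * by assumption.
  - intros x Hx. apply HF. lra.
  - intros x Hx. apply is_derive_continuity_pt with (f x). now apply HF.
  - generalize (Hf c Hc). nra.
Qed.

(** Both G - F and G + F are nondecreasing. *)
Lemma dominated_increment (F G f g : R -> R) (a b : R) :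
  a <= b ->
  (forall x, a <= x <= b -> is_derive F x (f x)) ->
  (forall x, a <= x <= b -> is_derive G x (g x)) ->
  (forall x, a <= x <= b -> Rabs (f x) <= g x) ->
  Rabs (F b - F a) <= G b - G a.
Proof.
  intros Hab HF HG Hfg.
  assert (Hup : G a - F a <= G b - F b).
  { apply (nondecreasing_of_nonneg_derivative (fun x => G x - F x) (fun x => g x - f x));
      [assumption | |]; intros x Hx.
    - apply (is_derive_minus G F x (g x) (f x)); auto.
    - generalize (Hfg x Hx). intros H. apply Rabs_le_between in H. lra. }
  assert (Hdn : G a + F a <= G b + F b).
  { apply (nondecreasing_of_nonneg_derivative (fun x => G x + F x) (fun x => g x + f x));
      [assumption | |]; intros x Hx.
    - apply (is_derive_plus G F x (g x) (f x)); auto.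
    - generalize (Hfg x Hx). intros H. apply Rabs_le_between in H. lra. }
  apply Rabs_le_between. lra.
Qed.

Lemma lipschitz_of_derivative_bound (F f : R -> R) (K x y : R) :
  (forall r, Rmin x y <= r <= Rmax x y -> is_derive F r (f r)) ->
  (forall r, Rmin x y <= r <= Rmax x y -> Rabs (f r) <= K) ->
  Rabs (F y - F x) <= K * Rabs (y - x).
Proof.
  intros HF Hf.
  destruct (MVT_gen F x y f) as [c [Hc E]].
  - intros r Hr. apply HF. lra.
  - intros r Hr. apply is_derive_continuity_pt with (f r). now apply HF.
  - rewrite E, Rabs_mult. apply Rmult_le_compat_r; [apply Rabs_pos | now apply Hf].
Qed.

Lemma between_zero_abs r s :
  Rmin 0 s <= r <= Rmax 0 s -> Rabs r <= Rabs s.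
Proof.
  unfold Rmin, Rmax, Rabs. destruct (Rle_dec 0 s), (Rcase_abs r), (Rcase_abs s); lra.
Qed.

Lemma exp_nondecreasing x y : x <= y -> exp x <= exp y.
Proof.
  intros [H | ->]; [left; now apply exp_increasing | apply Rle_refl].
Qed.

(** Integration from 0 gains the factor 1/c on functions measured against the weight
exp(c |s|).  Hence a Volterra operator of Lipschitz constant L becomes a
contraction of ratio 1/2 for the weight c = 2 L, on an interval of any length. *)
Lemma exponential_weight_integration (F f : R -> R) (B c s : R) :
  0 < c -> 0 <= B -> F 0 = 0 ->
  (forall r, is_derive F r (f r)) ->
  (forall r, Rabs r <= Rabs s -> Rabs (f r) <= B * exp (c * Rabs r)) ->
  Rabs (F s) <= B / c * exp (c * Rabs s).
Proof.
  intros Hc HB F0 HF Hf.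
  assert (HBc : 0 <= B / c) by (apply Rdiv_le_0_compat; assumption).
  destruct (Rle_dec 0 s) as [Hs | Hs].
  - rewrite (Rabs_pos_eq s) in * by assumption.
    assert (D : Rabs (F s - F 0) <= B / c * exp (c * s) - B / c * exp (c * 0)).
    { apply (dominated_increment F (fun r => B / c * exp (c * r)) f
               (fun r => B * exp (c * r)) 0 s); [assumption | now intros | |].
      - intros x _. auto_derive; [trivial | field; lra].
      - intros x Hx. replace (c * x) with (c * Rabs x).
        + apply Hf. rewrite Rabs_pos_eq; lra.
        + rewrite Rabs_pos_eq; lra. }
    rewrite F0, Rminus_0_r, Rmult_0_r, exp_0 in D. lra.
  - rewrite (Rabs_left s) in * by lra.
    assert (D : Rabs (F 0 - F s) <= - (B / c) * exp (- c * 0) - - (B / c) * exp (- c * s)).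
    { apply (dominated_increment F (fun r => - (B / c) * exp (- c * r)) f
               (fun r => B * exp (- c * r)) s 0); [lra | now intros | |].
      - intros x _. auto_derive; [trivial | field; lra].
      - intros x Hx. replace (- c * x) with (c * Rabs x).
        + apply Hf. rewrite Rabs_left1; lra.
        + rewrite Rabs_left1; lra. }
    rewrite F0, Rmult_0_r, exp_0, Rminus_0_l, Rabs_Ropp in D.
    replace (- c * s) with (c * - s) in D by ring. lra.
Qed.

Lemma geometric_steps_converge (a : nat -> R) (E : R) :
  (forall n, Rabs (a (S n) - a n) <= E * (/ 2) ^ n) ->
  forall n, Rabs (real (Lim_seq a) - a n) <= 2 * E * (/ 2) ^ n.
Proof.
  intros Ha.
  assert (HE : 0 <= E).
  { generalize (Ha O) (Rabs_pos (a 1%nat - a O)). simpl. lra. }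
  assert (Htail : forall n k, Rabs (a (n + k)%nat - a n) <= 2 * E * ((/ 2) ^ n - (/ 2) ^ (n + k))).
  { intros n k. induction k as [|k IH].
    - rewrite Nat.add_0_r, Rminus_diag, Rabs_R0. lra.
    - rewrite Nat.add_succ_r.
      replace (a (S (n + k)) - a n) with ((a (S (n + k)) - a (n + k)%nat) + (a (n + k)%nat - a n)) by ring.
      eapply Rle_trans; [apply Rabs_triang |].
      generalize (Ha (n + k)%nat). simpl. lra. }
  assert (Hbd : forall n k, Rabs (a (n + k)%nat - a n) <= 2 * E * (/ 2) ^ n).
  { intros n k. eapply Rle_trans; [apply Htail |].
    assert (0 < (/ 2) ^ (n + k)) by (apply pow_lt; lra). nra. }
  assert (Hcv : ex_finite_lim_seq a).
  { apply ex_lim_seq_cauchy_corr. intros eps.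
    assert (Hz : is_lim_seq (fun n => 4 * E * (/ 2) ^ n) 0).
    { replace (Finite 0) with (Rbar_mult (4 * E) 0) by (simpl; f_equal; ring).
      apply is_lim_seq_scal_l, is_lim_seq_geom. rewrite Rabs_pos_eq; lra. }
    apply is_lim_seq_spec in Hz. destruct (Hz eps) as [N HN].
    exists N. intros n m Hn Hm.
    specialize (HN N (Nat.le_refl N)).
    rewrite Rminus_0_r in HN. apply Rabs_lt_between in HN.
    replace n with (N + (n - N))%nat by lia. replace m with (N + (m - N))%nat by lia.
    replace (a (N + (n - N))%nat - a (N + (m - N))%nat)
      with ((a (N + (n - N))%nat - a N) + - (a (N + (m - N))%nat - a N)) by ring.
    eapply Rle_lt_trans; [apply Rabs_triang |]. rewrite Rabs_Ropp.
    generalize (Hbd N (n - N)%nat) (Hbd N (m - N)%nat). lra. }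
  intros n. apply Lim_seq_correct' in Hcv.
  assert (Hk : is_lim_seq (fun k => Rabs (a (n + k)%nat - a n)) (Rabs (real (Lim_seq a) - a n))).
  { apply (is_lim_seq_abs (fun k => a (n + k)%nat - a n) (Finite (real (Lim_seq a) - a n))).
    apply is_lim_seq_minus'; [| apply is_lim_seq_const].
    apply is_lim_seq_ext with (fun k => a (k + n)%nat); [intros k; f_equal; lia |].
    now apply is_lim_seq_incr_n. }
  assert (Hc : is_lim_seq (fun _ => 2 * E * (/ 2) ^ n) (2 * E * (/ 2) ^ n)) by apply is_lim_seq_const.
  exact (is_lim_seq_le _ _ _ _ (fun k => Hbd n k) Hk Hc).
Qed.

Fixpoint picard (f : (R -> R) -> R -> R) (n : nat) : R -> R :=
  match n with
  | O => fun _ => 0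
  | S n' => fun s => RInt (f (picard f n')) 0 s
  end.

Lemma is_derive_RInt_continuous (g : R -> R) :
  (forall s, continuous g s) -> forall s, is_derive (fun r => RInt g 0 r) s (g s).
Proof.
  intros Hg s. apply (is_derive_RInt g _ 0 s); [| apply Hg].
  apply filter_forall. intros r. apply (RInt_correct g), (ex_RInt_continuous g).
  intros z _. apply Hg.
Qed.

Lemma continuous_of_derivative (F f : R -> R) :
  (forall s, is_derive F s (f s)) -> forall s, continuous F s.
Proof.
  intros H s. apply (ex_derive_continuous F). now exists (f s).
Qed.

Lemma continuous_bounded_on_interval (g : R -> R) (A : R) :
  (forall s, continuous g s) ->
  exists M, 0 <= M /\ forall s, Rabs s <= A -> Rabs (g s) <= M.
Proof.
  intros Hg. destruct (Rle_dec 0 A) as [HA | HA].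
  - destruct (continuity_ab_maj (fun s => Rabs (g s)) (- A) A) as [m [Hm _]]; [lra | |].
    + intros c _. apply (continuity_pt_comp g Rabs); [| apply Rcontinuity_abs].
      apply continuity_pt_filterlim, Hg.
    + exists (Rabs (g m)). split; [apply Rabs_pos |].
      intros s Hs. apply Hm. now apply Rabs_le_between.
  - exists 0. split; [lra |]. intros s Hs. generalize (Rabs_pos s). lra.
Qed.

(** The second hypothesis is causality with a quantitative bound: [f u s] depends on u
only through its values between -|s| and |s|, and the Lipschitz constant may grow
with |s|.  The Picard iterates are defined on the whole line, and for |s| <= A
consecutive ones differ by O(2^-n) for a suitable exponential weight, so they
converge locally uniformly on the whole line. *)
Theorem causal_ode_global_solution (f : (R -> R) -> R -> R) :
  (forall u, (forall s, continuous u s) -> forall s, continuous (f u) s) ->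
  (forall A, exists L, forall u v,
     (forall s, continuous u s) -> (forall s, continuous v s) ->
     forall s D, Rabs s <= A ->
       (forall r, Rabs r <= Rabs s -> Rabs (u r - v r) <= D) ->
       Rabs (f u s - f v s) <= L * D) ->
  exists u, u 0 = 0 /\ forall s, is_derive u s (f u s).
Proof.
  intros Hcont Hlip.
  assert (Pc : forall n s, continuous (picard f n) s).
  { induction n as [|n IH]; intros s; simpl.
    - apply continuous_const.
    - apply (continuous_of_derivative _ (f (picard f n))).
      apply is_derive_RInt_continuous, Hcont, IH. }
  assert (Pd : forall n s, is_derive (picard f (S n)) s (f (picard f n) s)).
  { intros n. apply (is_derive_RInt_continuous (f (picard f n))), Hcont, Pc. }
  assert (P0 : forall n, picard f n 0 = 0).
  { destruct n; simpl; [reflexivity | apply (RInt_point 0 (f (picard f n)))]. }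
  set (u := fun s => real (Lim_seq (fun n => picard f n s))).
  assert (Hu : forall A, exists E, forall n s, Rabs s <= A ->
                 Rabs (u s - picard f n s) <= E * (/ 2) ^ n).
  { intros A. destruct (Hlip A) as [L0 HL0].
    set (L := Rmax L0 1). assert (HL1 : 1 <= L) by apply Rmax_r.
    destruct (continuous_bounded_on_interval (picard f 1) A (Pc 1%nat)) as [B [HB Bb]].
    assert (Hstep : forall n s, Rabs s <= A ->
              Rabs (picard f (S n) s - picard f n s)
              <= B * (/ 2) ^ n * exp (2 * L * Rabs s)).
    { induction n as [|n IH]; intros s Hs.
      - simpl. rewrite Rminus_0_r.
        eapply Rle_trans; [exact (Bb s Hs) |].
        assert (1 <= exp (2 * L * Rabs s)).
        { rewrite <- exp_0. apply exp_nondecreasing. generalize (Rabs_pos s). nra. }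
        nra.
      - assert (Hp : 0 < (/ 2) ^ n) by (apply pow_lt; lra).
        replace (B * (/ 2) ^ S n) with (L * (B * (/ 2) ^ n) / (2 * L)) by (simpl; field; lra).
        apply (exponential_weight_integration
                 (fun s => picard f (S (S n)) s - picard f (S n) s)
                 (fun s => f (picard f (S n)) s - f (picard f n) s)); [lra | | | |].
        + assert (0 <= B * (/ 2) ^ n) by nra. nra.
        + rewrite !P0. ring.
        + intros r. apply (is_derive_minus (picard f (S (S n))) (picard f (S n))); apply Pd.
        + intros r Hr.
          rewrite Rmult_assoc.
          set (D := B * (/ 2) ^ n * exp (2 * L * Rabs r)).
          assert (HD : Rabs (f (picard f (S n)) r - f (picard f n) r) <= L0 * D).
          { apply HL0; [apply Pc | apply Pc | lra |].
            intros q Hq. eapply Rle_trans; [apply IH; lra |].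
            unfold D. apply Rmult_le_compat_l; [nra |]. apply exp_nondecreasing. nra. }
          assert (0 <= D).
          { unfold D. generalize (exp_pos (2 * L * Rabs r)). intros He.
            apply Rmult_le_pos; [nra | lra]. }
          assert (L0 <= L) by apply Rmax_l. nra. }
    (* Twice the first step, since the steps shrink like 2^-n, with the weight
       replaced by its maximum on [-A, A]. *)
    exists (2 * (B * exp (2 * L * A))). intros n s Hs.
    apply (geometric_steps_converge (fun n => picard f n s)).
    intros m. eapply Rle_trans; [exact (Hstep m s Hs) |].
    replace (B * exp (2 * L * A) * (/ 2) ^ m) with (B * (/ 2) ^ m * exp (2 * L * A)) by ring.
    apply Rmult_le_compat_l.
    - assert (0 < (/ 2) ^ m) by (apply pow_lt; lra). nra.
    - apply exp_nondecreasing. nra. }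
  assert (Hvanish : forall E, is_lim_seq (fun n => E * (/ 2) ^ n) 0).
  { intros E. replace (Finite 0) with (Rbar_mult E 0) by (simpl; f_equal; ring).
    apply is_lim_seq_scal_l, is_lim_seq_geom. rewrite Rabs_pos_eq; lra. }
  assert (uc : forall s, continuous u s).
  { intros s. apply continuity_pt_filterlim.
    assert (Hr : 0 < Rabs s + 1) by (generalize (Rabs_pos s); lra).
    apply (CVU_continuity (picard f) u 0 (mkposreal _ Hr)).
    - intros eps Heps. destruct (Hu (Rabs s + 1)) as [E HE].
      generalize (Hvanish E). intros Hz. apply is_lim_seq_spec in Hz.
      destruct (Hz (mkposreal eps Heps)) as [N HN]. exists N. intros n y Hn Hy.
      unfold Boule in Hy. simpl in Hy. rewrite Rminus_0_r in Hy.
      specialize (HN n Hn). rewrite Rminus_0_r in HN. apply Rabs_lt_between in HN. simpl in HN.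
      eapply Rle_lt_trans; [apply HE; lra | apply HN].
    - intros n y _. apply continuity_pt_filterlim, Pc.
    - unfold Boule. simpl. rewrite Rminus_0_r. lra. }
  assert (Hfix : forall s, u s = RInt (f u) 0 s).
  { intros s. destruct (Hu (Rabs s)) as [E HE], (Hlip (Rabs s)) as [L HL].
    assert (Hd : forall n, Rabs (u s - RInt (f u) 0 s)
                           <= (E + L * E * Rabs s) * (/ 2) ^ n).
    { intros n.
      replace (u s - RInt (f u) 0 s)
        with ((u s - picard f (S n) s)
              + ((picard f (S n) s - RInt (f u) 0 s)
                 - (picard f (S n) 0 - RInt (f u) 0 0))).
      2: { rewrite P0. change (RInt (f u) 0 0) with (RInt (V := R_CompleteNormedModule) (f u) 0 0).
           rewrite RInt_point. change (@zero R_CompleteNormedModule) with 0. ring. }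
      eapply Rle_trans; [apply Rabs_triang |].
      assert (H1 : Rabs (u s - picard f (S n) s) <= E * (/ 2) ^ n).
      { eapply Rle_trans; [apply HE; lra |]. simpl.
        assert (Hq : 0 <= E * (/ 2) ^ n).
        { eapply Rle_trans; [apply Rabs_pos | apply (HE n s); lra]. }
        lra. }
      assert (H2 : Rabs (picard f (S n) s - RInt (f u) 0 s - (picard f (S n) 0 - RInt (f u) 0 0))
                   <= L * (E * (/ 2) ^ n) * Rabs (s - 0)).
      { apply (lipschitz_of_derivative_bound
                 (fun s => picard f (S n) s - RInt (f u) 0 s)
                 (fun s => f (picard f n) s - f u s)).
        - intros r _. apply (is_derive_minus (picard f (S n)) (fun s => RInt (f u) 0 s)); [apply Pd |].
          apply is_derive_RInt_continuous, Hcont, uc.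
        - intros r Hr. apply between_zero_abs in Hr.
          apply HL; [apply Pc | apply uc | assumption |].
          intros q Hq. rewrite Rabs_minus_sym. apply HE. lra. }
      rewrite Rminus_0_r in H2. lra. }
    assert (Hz : Rabs (u s - RInt (f u) 0 s) <= 0).
    { exact (is_lim_seq_le _ _ _ _ Hd (is_lim_seq_const _) (Hvanish (E + L * E * Rabs s))). }
    apply Rminus_diag_uniq. generalize (Rabs_pos (u s - RInt (f u) 0 s)). intros Hp.
    apply Rabs_eq_0. lra. }
  exists u. split.
  - rewrite Hfix. apply (RInt_point 0 (f u)).
  - intros s. apply is_derive_ext with (fun s => RInt (f u) 0 s); [intros t; now rewrite <- Hfix |].
    apply is_derive_RInt_continuous, Hcont, uc.
Qed.

(** * Functions of class C^k and locally Lipschitz functions *)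

Fixpoint Ck (k : nat) (f : R -> R) : Prop :=
  match k with
  | O => forall x, continuous f x
  | S k' => (forall x, ex_derive f x) /\ Ck k' (Derive f)
  end.

Lemma Ck_of_derivative k (F f : R -> R) :
  (forall s, is_derive F s (f s)) -> Ck k f -> Ck (S k) F.
Proof.
  intros HF Hf. split.
  - intros s. now exists (f s).
  - replace (Derive F) with f; [assumption |].
    apply functional_extensionality. intros s. symmetry. now apply is_derive_unique.
Qed.

Lemma Ck_pred k f : Ck (S k) f -> Ck k f.
Proof.
  revert f. induction k as [|k IH]; intros f [Hd Hk].
  - intros x. now apply (ex_derive_continuous f).
  - split; [assumption | now apply IH].
Qed.

Lemma Ck_is_derive k f : Ck (S k) f -> forall s, is_derive f s (Derive f s).
Proof. intros [Hf _] s. now apply Derive_correct. Qed.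

Lemma Ck_const k c : Ck k (fun _ => c).
Proof.
  revert c. induction k as [|k IH]; intros c.
  - intros x. apply continuous_const.
  - apply Ck_of_derivative with (fun _ => 0); [| apply IH].
    intros s. apply (is_derive_const c).
Qed.

Lemma Ck_plus k f g : Ck k f -> Ck k g -> Ck k (fun s => f s + g s).
Proof.
  revert f g. induction k as [|k IH]; intros f g Hf Hg.
  - intros x. apply (continuous_plus f g); auto.
  - apply Ck_of_derivative with (fun s => Derive f s + Derive g s).
    + intros s. apply (is_derive_plus f g); eapply Ck_is_derive; eassumption.
    + apply IH; [apply Hf | apply Hg].
Qed.

Lemma Ck_mult k f g : Ck k f -> Ck k g -> Ck k (fun s => f s * g s).
Proof.
  revert f g. induction k as [|k IH]; intros f g Hf Hg.
  - intros x. apply (continuous_mult f g); auto.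
  - apply Ck_of_derivative with (fun s => Derive f s * g s + f s * Derive g s).
    + intros s. apply (is_derive_mult f g); [| | intros; apply Rmult_comm];
        eapply Ck_is_derive; eassumption.
    + apply Ck_plus; apply IH; auto using Ck_pred; [apply Hf | apply Hg].
Qed.

Lemma Ck_opp k f : Ck k f -> Ck k (fun s => - f s).
Proof.
  intros Hf. replace (fun s => - f s) with (fun s => -1 * f s).
  - apply Ck_mult; [apply Ck_const | assumption].
  - apply functional_extensionality. intros s. ring.
Qed.

(** The two claims are proved together because differentiation exchanges cosine
and sine. *)
Lemma Ck_cos_sin k f :
  Ck k f -> Ck k (fun s => cos (f s)) /\ Ck k (fun s => sin (f s)).
Proof.
  revert f. induction k as [|k IH]; intros f Hf.
  - split; intros x.
    + apply (continuous_comp f cos); [apply Hf | apply continuous_cos].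
    + apply (continuous_comp f sin); [apply Hf | apply continuous_sin].
  - destruct (IH f (Ck_pred k f Hf)) as [Hc Hs]. split.
    + apply Ck_of_derivative with (fun s => Derive f s * - sin (f s)).
      * intros s. apply (is_derive_comp cos f); [apply is_derive_cos |].
        eapply Ck_is_derive; eassumption.
      * apply Ck_mult; [apply Hf | now apply Ck_opp].
    + apply Ck_of_derivative with (fun s => Derive f s * cos (f s)).
      * intros s. apply (is_derive_comp sin f); [apply is_derive_sin |].
        eapply Ck_is_derive; eassumption.
      * apply Ck_mult; [apply Hf | assumption].
Qed.

Lemma Ck_inv k f : (forall s, f s <> 0) -> Ck k f -> Ck k (fun s => / f s).
Proof.
  intros H0. revert f H0. induction k as [|k IH]; intros f H0 Hf.
  - intros x. apply (continuous_comp f Rinv); [apply Hf |].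
    apply continuous_Rinv, H0.
  - apply Ck_of_derivative with (fun s => - Derive f s * (/ f s * / f s)).
    + intros s. replace (- Derive f s * (/ f s * / f s)) with (- Derive f s / f s ^ 2)
        by (field; apply H0).
      apply is_derive_inv; [eapply Ck_is_derive; eassumption | apply H0].
    + assert (Hi : Ck k (fun s => / f s)) by (apply IH; [| apply Ck_pred]; assumption).
      apply Ck_mult; [apply Ck_opp, Hf | now apply Ck_mult].
Qed.

(** The derivative f' / (2 sqrt f) involves sqrt f itself, which is of one class
less by induction. *)
Lemma Ck_sqrt k f : (forall s, 0 < f s) -> Ck k f -> Ck k (fun s => sqrt (f s)).
Proof.
  intros H0. revert f H0. induction k as [|k IH]; intros f H0 Hf.
  - intros x. apply (continuous_comp f sqrt); [apply Hf | apply continuous_sqrt].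
  - apply Ck_of_derivative with (fun s => Derive f s * / (2 * sqrt (f s))).
    + intros s. apply is_derive_sqrt; [eapply Ck_is_derive; eassumption | apply H0].
    + apply Ck_mult; [apply Hf |]. apply Ck_inv.
      * intros s. generalize (sqrt_lt_R0 (f s) (H0 s)). lra.
      * apply Ck_mult; [apply Ck_const |]. apply IH; [| apply Ck_pred]; assumption.
Qed.

Lemma smooth1_of_Ck f : (forall k, Ck k f) -> smooth1 f.
Proof.
  intros Hf k x. destruct k as [|k]; simpl; [trivial |].
  assert (H : forall j m, Ck (j + m) f -> Ck m (Derive_n f j)).
  { induction j as [|j IH]; intros m Hm; [exact Hm |].
    change (Derive_n f (S j)) with (Derive (Derive_n f j)).
    apply (IH (S m)). now rewrite Nat.add_succ_r. }
  apply (H k 1%nat), Hf.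
Qed.

(** Continuity of one partial derivative and existence of the other suffice for
total differentiability, from which the chain rule along a curve follows. *)
Lemma class_C1_differentiable f :
  class_C 1 f -> forall x y,
  differentiable_pt_lim f x y (Derive (fun u => f u y) x) (Derive (fun v => f x v) y).
Proof.
  intros [Hd [Hx _]] x y. apply filterdiff_differentiable_pt_lim.
  apply (is_derive_filterdiff f x y (fun x y => Derive (fun u => f u y) x)).
  - apply filter_forall. intros u. apply (Derive_correct (fun z => f z (snd u))), (proj1 (Hd (fst u) (snd u))).
  - apply (Derive_correct (fun z => f x z)), (proj2 (Hd x y)).
  - apply (continuity_2d_pt_filterlim (fun x y => Derive (fun u => f u y) x)), Hx.
Qed.

Lemma class_C_pred k f : class_C (S k) f -> class_C k f.
Proof.
  revert f. induction k as [|k IH]; intros f Hf.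
  - intros x y. apply differentiable_continuity_pt.
    eexists. eexists. now apply class_C1_differentiable.
  - destruct Hf as [Hd [Hx Hy]]. split; [exact Hd | split; now apply IH].
Qed.

Lemma class_C1_of_class_C k f : class_C (S k) f -> class_C 1 f.
Proof.
  induction k as [|k IH]; [trivial |]. intros Hf. apply IH. now apply class_C_pred.
Qed.

Lemma Ck_comp_2d k f a b :
  class_C k f -> Ck k a -> Ck k b -> Ck k (fun s => f (a s) (b s)).
Proof.
  revert f a b. induction k as [|k IH]; intros f a b Hf Ha Hb.
  - intros x. apply (continuous_comp_2 a b f); auto.
    apply (continuity_2d_pt_filterlim f), Hf.
  - apply Ck_of_derivative with
      (fun s => Derive (fun u => f u (b s)) (a s) * Derive a s
                + Derive (fun v => f (a s) v) (b s) * Derive b s).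
    + intros s. apply is_derive_Reals. apply derivable_pt_lim_comp_2d.
      * apply class_C1_differentiable. eapply class_C1_of_class_C; eassumption.
      * apply is_derive_Reals. eapply Ck_is_derive; eassumption.
      * apply is_derive_Reals. eapply Ck_is_derive; eassumption.
    + destruct Hf as [_ [Hx Hy]].
      apply Ck_plus; apply Ck_mult.
      * apply (IH _ a b Hx); now apply Ck_pred.
      * apply Ha.
      * apply (IH _ a b Hy); now apply Ck_pred.
      * apply Hb.
Qed.

(** The coordinates of a helicoidal surface are sums of such products. *)
Lemma class_C_mult_separate k a b :
  Ck k a -> Ck k b -> class_C k (fun s t => a s * b t).
Proof.
  revert a b. induction k as [|k IH]; intros a b Ha Hb.
  - intros x y. apply continuity_2d_pt_mult.
    + apply (continuity_1d_2d_pt_comp a (fun u _ => u)); [| apply continuity_2d_pt_id1].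
      apply continuity_pt_filterlim, Ha.
    + apply (continuity_1d_2d_pt_comp b (fun _ v => v)); [| apply continuity_2d_pt_id2].
      apply continuity_pt_filterlim, Hb.
  - split; [| split].
    + intros x y. split.
      * apply (ex_derive_mult a (fun _ => b y)); [apply Ha | apply ex_derive_const].
      * apply (ex_derive_mult (fun _ => a x) b); [apply ex_derive_const | apply Hb].
    + replace (fun x y => Derive (fun u => a u * b y) x) with (fun x y => Derive a x * b y).
      * apply IH; [apply Ha | now apply Ck_pred].
      * do 2 (apply functional_extensionality; intro). symmetry. apply Derive_scal_l.
    + replace (fun x y => Derive (fun v => a x * b v) y) with (fun x y => a x * Derive b y).
      * apply IH; [now apply Ck_pred | apply Hb].
      * do 2 (apply functional_extensionality; intro). symmetry. apply Derive_scal.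
Qed.

Lemma class_C_plus k f g :
  class_C k f -> class_C k g -> class_C k (fun s t => f s t + g s t).
Proof.
  revert f g. induction k as [|k IH]; intros f g Hf Hg.
  - intros x y. apply continuity_2d_pt_plus; [apply Hf | apply Hg].
  - destruct Hf as [Hf [Hfx Hfy]], Hg as [Hg [Hgx Hgy]]. split; [| split].
    + intros x y. split.
      * apply (ex_derive_plus (fun u => f u y) (fun u => g u y)); [apply (proj1 (Hf x y)) | apply (proj1 (Hg x y))].
      * apply (ex_derive_plus (f x) (g x)); [apply (proj2 (Hf x y)) | apply (proj2 (Hg x y))].
    + replace (fun x y => Derive (fun u => f u y + g u y) x)
        with (fun x y => Derive (fun u => f u y) x + Derive (fun u => g u y) x).
      * now apply IH.
      * apply functional_extensionality; intro x. apply functional_extensionality; intro y. symmetry.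
        apply (Derive_plus (fun u => f u y) (fun u => g u y)); [apply (proj1 (Hf x y)) | apply (proj1 (Hg x y))].
    + replace (fun x y => Derive (fun v => f x v + g x v) y)
        with (fun x y => Derive (fun v => f x v) y + Derive (fun v => g x v) y).
      * now apply IH.
      * apply functional_extensionality; intro x. apply functional_extensionality; intro y. symmetry.
        apply (Derive_plus (f x) (g x)); [apply (proj2 (Hf x y)) | apply (proj2 (Hg x y))].
Qed.

(** A Lipschitz constant on each square, not only near each point: the Picard
estimates need one constant for all values that the curve can take. *)
Definition locally_lipschitz2 (f : R -> R -> R) : Prop :=
  forall A, exists L, 0 <= L /\
    forall x y x' y', Rabs x <= A -> Rabs y <= A -> Rabs x' <= A -> Rabs y' <= A ->
      Rabs (f x y - f x' y') <= L * (Rabs (x - x') + Rabs (y - y')).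

Lemma locally_lipschitz2_bounded f :
  locally_lipschitz2 f -> forall A, exists M, 0 <= M /\
    forall x y, Rabs x <= A -> Rabs y <= A -> Rabs (f x y) <= M.
Proof.
  intros Hf A. destruct (Hf A) as [L [HL Hl]].
  exists (Rabs (f 0 0) + L * (Rabs A + Rabs A)). split.
  - generalize (Rabs_pos (f 0 0)) (Rabs_pos A). nra.
  - intros x y Hx Hy.
    assert (HA : A <= Rabs A) by apply Rle_abs.
    assert (H0 : Rabs 0 <= A) by (rewrite Rabs_R0; generalize (Rabs_pos x); lra).
    generalize (Hl x y 0 0 Hx Hy H0 H0). rewrite !Rminus_0_r. intros H.
    replace (f x y) with (f 0 0 + (f x y - f 0 0)) by ring.
    eapply Rle_trans; [apply Rabs_triang |]. nra.
Qed.

Lemma locally_lipschitz2_fst : locally_lipschitz2 (fun x _ => x).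
Proof.
  intros A. exists 1. split; [lra |]. intros x y x' y' _ _ _ _.
  generalize (Rabs_pos (y - y')). lra.
Qed.

Lemma locally_lipschitz2_snd : locally_lipschitz2 (fun _ y => y).
Proof.
  intros A. exists 1. split; [lra |]. intros x y x' y' _ _ _ _.
  generalize (Rabs_pos (x - x')). lra.
Qed.

Lemma locally_lipschitz2_const c : locally_lipschitz2 (fun _ _ => c).
Proof.
  intros A. exists 0. split; [lra |]. intros x y x' y' _ _ _ _.
  rewrite Rminus_diag, Rabs_R0. lra.
Qed.

Lemma locally_lipschitz2_plus f g :
  locally_lipschitz2 f -> locally_lipschitz2 g -> locally_lipschitz2 (fun x y => f x y + g x y).
Proof.
  intros Hf Hg A. destruct (Hf A) as [L [HL Hl]], (Hg A) as [M [HM Hm]].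
  exists (L + M). split; [lra |]. intros x y x' y' Hx Hy Hx' Hy'.
  replace (f x y + g x y - (f x' y' + g x' y'))
    with ((f x y - f x' y') + (g x y - g x' y')) by ring.
  eapply Rle_trans; [apply Rabs_triang |].
  generalize (Hl x y x' y' Hx Hy Hx' Hy') (Hm x y x' y' Hx Hy Hx' Hy'). lra.
Qed.

Lemma locally_lipschitz2_mult f g :
  locally_lipschitz2 f -> locally_lipschitz2 g -> locally_lipschitz2 (fun x y => f x y * g x y).
Proof.
  intros Hf Hg A.
  destruct (locally_lipschitz2_bounded f Hf A) as [Bf [HBf Hbf]].
  destruct (locally_lipschitz2_bounded g Hg A) as [Bg [HBg Hbg]].
  destruct (Hf A) as [L [HL Hl]], (Hg A) as [M [HM Hm]].
  exists (L * Bg + Bf * M). split; [nra |]. intros x y x' y' Hx Hy Hx' Hy'.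
  replace (f x y * g x y - f x' y' * g x' y')
    with ((f x y - f x' y') * g x y + f x' y' * (g x y - g x' y')) by ring.
  eapply Rle_trans; [apply Rabs_triang |]. rewrite !Rabs_mult.
  set (d := Rabs (x - x') + Rabs (y - y')).
  replace ((L * Bg + Bf * M) * d) with ((L * d) * Bg + Bf * (M * d)) by ring.
  apply Rplus_le_compat; apply Rmult_le_compat; try apply Rabs_pos; auto.
Qed.

Lemma locally_lipschitz2_inv f m :
  0 < m -> (forall x y, m <= f x y) ->
  locally_lipschitz2 f -> locally_lipschitz2 (fun x y => / f x y).
Proof.
  intros Hm Hfm Hf A. destruct (Hf A) as [L [HL Hl]].
  assert (Hmm : 0 < / (m * m)) by (apply Rinv_0_lt_compat; nra).
  exists (L * / (m * m)). split; [nra |]. intros x y x' y' Hx Hy Hx' Hy'.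
  assert (H1 := Hfm x y). assert (H2 := Hfm x' y').
  replace (/ f x y - / f x' y') with ((f x' y' - f x y) * / (f x y * f x' y'))
    by (field; lra).
  rewrite Rabs_mult, Rabs_minus_sym, (Rabs_pos_eq (/ _)).
  2: { left. apply Rinv_0_lt_compat. nra. }
  replace (L * / (m * m) * (Rabs (x - x') + Rabs (y - y')))
    with ((L * (Rabs (x - x') + Rabs (y - y'))) * / (m * m)) by ring.
  apply Rmult_le_compat; [apply Rabs_pos | | now apply Hl |].
  - left. apply Rinv_0_lt_compat. nra.
  - apply Rinv_le_contravar; nra.
Qed.

Lemma locally_lipschitz2_sqrt f m :
  0 < m -> (forall x y, m <= f x y) ->
  locally_lipschitz2 f -> locally_lipschitz2 (fun x y => sqrt (f x y)).
Proof.
  intros Hm Hfm Hf A. destruct (Hf A) as [L [HL Hl]].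
  assert (Hs : 0 < sqrt m) by now apply sqrt_lt_R0.
  assert (Hi : 0 < / sqrt m) by now apply Rinv_0_lt_compat.
  exists (L * / sqrt m). split; [nra |]. intros x y x' y' Hx Hy Hx' Hy'.
  assert (H1 := sqrt_le_1_alt _ _ (Hfm x y)). assert (H2 := sqrt_le_1_alt _ _ (Hfm x' y')).
  assert (E : f x y - f x' y' = (sqrt (f x y) - sqrt (f x' y')) * (sqrt (f x y) + sqrt (f x' y'))).
  { rewrite <- (sqrt_sqrt (f x y)) at 1 by (generalize (Hfm x y); lra).
    rewrite <- (sqrt_sqrt (f x' y')) at 1 by (generalize (Hfm x' y'); lra). ring. }
  generalize (Hl x y x' y' Hx Hy Hx' Hy').
  rewrite E, Rabs_mult, (Rabs_pos_eq (sqrt (f x y) + _)) by lra. intros H.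
  apply Rmult_le_reg_r with (sqrt m); [assumption |].
  replace (L * / sqrt m * (Rabs (x - x') + Rabs (y - y')) * sqrt m)
    with (L * (Rabs (x - x') + Rabs (y - y'))) by (field; lra).
  eapply Rle_trans; [| exact H].
  apply Rmult_le_compat_l; [apply Rabs_pos | lra].
Qed.

(** Along the segment from the origin to (x,y), cut into N equal parts that are short
for the modulus of uniform continuity, the function varies by less than 1 on each
part. *)
Lemma continuous_2d_bounded_on_square f A :
  (forall x y, continuity_2d_pt f x y) ->
  exists M, 0 <= M /\ forall x y, Rabs x <= A -> Rabs y <= A -> Rabs (f x y) <= M.
Proof.
  intros Hf.
  destruct (uniform_continuity_2d f (- A) A (- A) A (fun x y _ _ => Hf x y) (mkposreal 1 Rlt_0_1))
    as [d Hd]. simpl in Hd.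
  assert (HA1 : 0 < Rabs A + 1) by (generalize (Rabs_pos A); lra).
  destruct (archimed_cor1 (d / (Rabs A + 1))) as [N [HN HN0]].
  { apply Rdiv_lt_0_compat; [apply cond_pos | assumption]. }
  assert (HNp : 0 < INR N) by now apply lt_0_INR.
  exists (Rabs (f 0 0) + INR N). split; [generalize (Rabs_pos (f 0 0)); lra |].
  intros x y Hx Hy.
  assert (HA : A <= Rabs A) by apply Rle_abs.
  assert (Hfrac : forall j, (j <= N)%nat -> 0 <= INR j / INR N <= 1).
  { intros j Hj. split.
    - apply Rdiv_le_0_compat; [apply pos_INR | assumption].
    - apply Rmult_le_reg_r with (INR N); [assumption |].
      unfold Rdiv. rewrite Rmult_assoc, Rinv_l, Rmult_1_r, Rmult_1_l by lra. now apply le_INR. }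
  assert (Hin : forall j z, (j <= N)%nat -> Rabs z <= A -> - A <= INR j / INR N * z <= A).
  { intros j z Hj Hz. apply Rabs_le_between in Hz. generalize (Hfrac j Hj). nra. }
  assert (Hsmall : forall j z, Rabs z <= A -> Rabs (INR (S j) / INR N * z - INR j / INR N * z) < d).
  { intros j z Hz. rewrite S_INR.
    replace ((INR j + 1) / INR N * z - INR j / INR N * z) with (/ INR N * z) by (field; lra).
    rewrite Rabs_mult, Rabs_pos_eq by (left; now apply Rinv_0_lt_compat).
    assert (0 < / INR N) by now apply Rinv_0_lt_compat.
    apply Rle_lt_trans with (/ INR N * (Rabs A + 1)); [apply Rmult_le_compat_l; lra |].
    apply Rmult_lt_reg_r with (/ (Rabs A + 1)); [now apply Rinv_0_lt_compat |].
    rewrite Rmult_assoc, Rinv_r, Rmult_1_r by lra. exact HN. }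
  assert (Hj : forall j, (j <= N)%nat ->
            Rabs (f (INR j / INR N * x) (INR j / INR N * y)) <= Rabs (f 0 0) + INR j).
  { induction j as [|j IH]; intros Hj.
    - simpl (INR 0). replace (0 / INR N * x) with 0 by (field; lra).
      replace (0 / INR N * y) with 0 by (field; lra). lra.
    - assert (Hj' : (j <= N)%nat) by lia.
      assert (D : Rabs (f (INR (S j) / INR N * x) (INR (S j) / INR N * y)
                        - f (INR j / INR N * x) (INR j / INR N * y)) < 1)
        by (apply Hd; auto).
      generalize (IH Hj') (Rabs_triang_inv (f (INR (S j) / INR N * x) (INR (S j) / INR N * y))
                             (f (INR j / INR N * x) (INR j / INR N * y))).
      rewrite S_INR in *. lra. }
  generalize (Hj N (Nat.le_refl N)).
  replace (INR N / INR N * x) with x by (field; lra).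
  replace (INR N / INR N * y) with y by (field; lra). trivial.
Qed.

Lemma convex_abs_bound A x x' r :
  Rabs x <= A -> Rabs x' <= A -> Rmin x' x <= r <= Rmax x' x -> Rabs r <= A.
Proof.
  rewrite !Rabs_le_between. unfold Rmin, Rmax. destruct (Rle_dec x' x); lra.
Qed.

(** The mean value theorem is applied along one coordinate direction after the
other; a square contains such a broken segment between any two of its points. *)
Lemma class_C1_locally_lipschitz2 f : class_C 1 f -> locally_lipschitz2 f.
Proof.
  intros [Hd [Hx Hy]] A.
  destruct (continuous_2d_bounded_on_square _ A Hx) as [L [HL Hl]].
  destruct (continuous_2d_bounded_on_square _ A Hy) as [M [HM Hm]].
  exists (L + M). split; [lra |]. intros x y x' y' Ax Ay Ax' Ay'.
  assert (H1 : Rabs (f x y - f x' y) <= L * Rabs (x - x')).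
  { apply (lipschitz_of_derivative_bound (fun u => f u y) (fun z => Derive (fun u => f u y) z)).
    - intros r _. apply (Derive_correct (fun u => f u y)), (proj1 (Hd r y)).
    - intros r Hr. apply Hl; [| assumption].
      exact (convex_abs_bound A x x' r Ax Ax' Hr). }
  assert (H2 : Rabs (f x' y - f x' y') <= M * Rabs (y - y')).
  { apply (lipschitz_of_derivative_bound (fun v => f x' v) (fun z => Derive (fun v => f x' v) z)).
    - intros r _. apply (Derive_correct (fun v => f x' v)), (proj2 (Hd x' r)).
    - intros r Hr. apply Hm; [assumption |].
      exact (convex_abs_bound A y y' r Ay Ay' Hr). }
  replace (f x y - f x' y') with ((f x y - f x' y) + (f x' y - f x' y')) by ring.
  eapply Rle_trans; [apply Rabs_triang |].
  generalize (Rabs_pos (x - x')) (Rabs_pos (y - y')). nra.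
Qed.

(** * Plane curves with prescribed curvature *)

Lemma locally_lipschitz2_continuous f : locally_lipschitz2 f -> class_C 0 f.
Proof.
  intros Hf x y eps.
  destruct (Hf (Rabs x + Rabs y + 1)) as [L [HL Hl]].
  assert (Hd : 0 < Rmin 1 (eps / (2 * (L + 1)))).
  { apply Rmin_pos; [lra |]. apply Rdiv_lt_0_compat; [apply cond_pos | lra]. }
  exists (mkposreal _ Hd). simpl. intros u v Hu Hv.
  assert (H1 := Rmin_l 1 (eps / (2 * (L + 1)))). assert (H2 := Rmin_r 1 (eps / (2 * (L + 1)))).
  assert (Px := Rabs_pos x). assert (Py := Rabs_pos y).
  assert (Tu := Rabs_triang_inv u x). assert (Tv := Rabs_triang_inv v y).
  assert (HE : eps = (2 * (L + 1)) * (eps / (2 * (L + 1))) :> R) by (field; lra).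
  assert (He := cond_pos eps).
  set (e := eps / (2 * (L + 1))) in *.
  eapply Rle_lt_trans; [apply Hl; lra |].
  rewrite HE. assert (0 < e) by nra.
  assert (Rabs (u - x) + Rabs (v - y) < 2 * e) by lra. nra.
Qed.

(** The plane curve (x,y) with X' = exp(i th) and curvature k. *)
Definition unit_speed_frame (x y th k : R -> R) : Prop :=
  forall s, is_derive x s (cos (th s)) /\ is_derive y s (sin (th s))
            /\ is_derive th s (k s).

(** The component tau of the position vector along the tangent exp(i th). *)
Definition tangential (x y th : R -> R) (s : R) : R :=
  x s * cos (th s) + y s * sin (th s).

(** The component nu of the position vector along the normal i exp(i th). *)
Definition transverse (x y th : R -> R) (s : R) : R :=
  y s * cos (th s) - x s * sin (th s).

Lemma Ck_tangential k x y th :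
  Ck k x -> Ck k y -> Ck k th -> Ck k (tangential x y th).
Proof.
  intros Hx Hy Ht. destruct (Ck_cos_sin k th Ht) as [Hc Hs].
  apply Ck_plus; now apply Ck_mult.
Qed.

Lemma Ck_transverse k x y th :
  Ck k x -> Ck k y -> Ck k th -> Ck k (transverse x y th).
Proof.
  intros Hx Hy Ht. destruct (Ck_cos_sin k th Ht) as [Hc Hs].
  apply (Ck_plus k (fun s => y s * cos (th s)) (fun s => - (x s * sin (th s))));
    [| apply Ck_opp]; now apply Ck_mult.
Qed.

Lemma Rabs_mult_le_1 a b : Rabs b <= 1 -> Rabs (a * b) <= Rabs a.
Proof.
  intros H. rewrite Rabs_mult. generalize (Rabs_pos a). nra.
Qed.

Lemma Rabs_cos_le_1 z : Rabs (cos z) <= 1.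
Proof. apply Rabs_le_between, COS_bound. Qed.

Lemma Rabs_sin_le_1 z : Rabs (sin z) <= 1.
Proof. apply Rabs_le_between, SIN_bound. Qed.

Lemma cos_1_lipschitz a b : Rabs (cos a - cos b) <= Rabs (a - b).
Proof.
  rewrite <- (Rmult_1_l (Rabs (a - b))).
  apply (lipschitz_of_derivative_bound cos (fun z => - sin z)); intros r _.
  - apply is_derive_cos.
  - rewrite Rabs_Ropp. apply Rabs_sin_le_1.
Qed.

Lemma sin_1_lipschitz a b : Rabs (sin a - sin b) <= Rabs (a - b).
Proof.
  rewrite <- (Rmult_1_l (Rabs (a - b))).
  apply (lipschitz_of_derivative_bound sin cos); intros r _.
  - apply is_derive_sin.
  - apply Rabs_cos_le_1.
Qed.

Lemma RInt_0_bound (g : R -> R) (K s : R) :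
  (forall r, continuous g r) ->
  (forall r, Rabs r <= Rabs s -> Rabs (g r) <= K) ->
  Rabs (RInt g 0 s) <= K * Rabs s.
Proof.
  intros Hg HK.
  assert (H : Rabs (RInt g 0 s - RInt g 0 0) <= K * Rabs (s - 0)).
  { apply (lipschitz_of_derivative_bound (fun s => RInt g 0 s) g).
    - intros r _. now apply is_derive_RInt_continuous.
    - intros r Hr. apply HK. now apply between_zero_abs. }
  change (RInt g 0 0) with (RInt (V := R_CompleteNormedModule) g 0 0) in H.
  rewrite RInt_point in H. change (@zero R_CompleteNormedModule) with 0 in H.
  now rewrite !Rminus_0_r in H.
Qed.

(** The angle is the only unknown: the curve is X = (integral of cos th, integral of
sin th), so |x(s)| and |y(s)| are at most |s| for every th, and a local Lipschitz
constant of [kap] is enough for the global existence theorem to apply. *)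
Theorem unit_speed_curve_with_prescribed_curvature (kap : R -> R -> R) :
  locally_lipschitz2 kap ->
  exists x y th, x 0 = 0 /\ y 0 = 0 /\
    unit_speed_frame x y th (fun s => kap (tangential x y th s) (transverse x y th s)).
Proof.
  intros Hkap.
  pose (X := fun th s => RInt (fun r => cos (th r)) 0 s).
  pose (Y := fun th s => RInt (fun r => sin (th r)) 0 s).
  assert (Cc : forall th, (forall s, continuous th s) -> forall s, continuous (fun r => cos (th r)) s)
    by (intros th Hth; exact (proj1 (Ck_cos_sin 0 th Hth))).
  assert (Cs : forall th, (forall s, continuous th s) -> forall s, continuous (fun r => sin (th r)) s)
    by (intros th Hth; exact (proj2 (Ck_cos_sin 0 th Hth))).
  assert (DX : forall th, (forall s, continuous th s) -> forall s, is_derive (X th) s (cos (th s)))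
    by (intros th Hth; apply is_derive_RInt_continuous, Cc, Hth).
  assert (DY : forall th, (forall s, continuous th s) -> forall s, is_derive (Y th) s (sin (th s)))
    by (intros th Hth; apply is_derive_RInt_continuous, Cs, Hth).
  destruct (causal_ode_global_solution
              (fun th s => kap (tangential (X th) (Y th) th s) (transverse (X th) (Y th) th s)))
    as [th [th0 Dth]].
  - intros th Hth.
    assert (CX := continuous_of_derivative _ _ (DX th Hth)).
    assert (CY := continuous_of_derivative _ _ (DY th Hth)).
    apply (Ck_comp_2d 0 kap).
    + now apply locally_lipschitz2_continuous.
    + now apply Ck_tangential.
    + now apply Ck_transverse.
  - intros A. destruct (Hkap (2 * Rabs A)) as [L [HL Hl]].
    (* The arguments tau and nu of kap are at most 2 |A|, and each consists of two
       products coordinate * (cos or sin) that change by at most 2 D |A|. *)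
    exists (L * (8 * Rabs A)). intros u v Hu Hv s D Hs HD.
    assert (Hs' : Rabs s <= Rabs A) by (generalize (Rle_abs A); lra).
    assert (PA := Rabs_pos s).
    assert (HD0 : 0 <= D) by (eapply Rle_trans; [apply Rabs_pos | apply (HD s); lra]).
    assert (BX : forall w, (forall s, continuous w s) -> Rabs (X w s) <= Rabs A).
    { intros w Hw. eapply Rle_trans; [apply (RInt_0_bound _ 1) |]; [now apply Cc | | lra].
      intros r _. apply Rabs_cos_le_1. }
    assert (BY : forall w, (forall s, continuous w s) -> Rabs (Y w s) <= Rabs A).
    { intros w Hw. eapply Rle_trans; [apply (RInt_0_bound _ 1) |]; [now apply Cs | | lra].
      intros r _. apply Rabs_sin_le_1. }
    assert (Dc : forall r, Rabs r <= Rabs s -> Rabs (cos (u r) - cos (v r)) <= D).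
    { intros r Hr. eapply Rle_trans; [apply cos_1_lipschitz | now apply HD]. }
    assert (Ds : forall r, Rabs r <= Rabs s -> Rabs (sin (u r) - sin (v r)) <= D).
    { intros r Hr. eapply Rle_trans; [apply sin_1_lipschitz | now apply HD]. }
    assert (IX : Rabs (X u s - X v s) <= D * Rabs A).
    { apply Rle_trans with (D * Rabs s); [| now apply Rmult_le_compat_l].
      replace (X u s - X v s) with (RInt (fun r => cos (u r) - cos (v r)) 0 s).
      - apply RInt_0_bound; [| assumption].
        intros r. apply (continuous_minus (fun r => cos (u r)) (fun r => cos (v r))); auto.
      - apply (RInt_minus (fun r => cos (u r)) (fun r => cos (v r)));
          apply (ex_RInt_continuous (V := R_CompleteNormedModule)); intros z _; auto. }
    assert (IY : Rabs (Y u s - Y v s) <= D * Rabs A).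
    { apply Rle_trans with (D * Rabs s); [| now apply Rmult_le_compat_l].
      replace (Y u s - Y v s) with (RInt (fun r => sin (u r) - sin (v r)) 0 s).
      - apply RInt_0_bound; [| assumption].
        intros r. apply (continuous_minus (fun r => sin (u r)) (fun r => sin (v r))); auto.
      - apply (RInt_minus (fun r => sin (u r)) (fun r => sin (v r)));
          apply (ex_RInt_continuous (V := R_CompleteNormedModule)); intros z _; auto. }
    assert (Prod : forall a b c d : R, Rabs c <= 1 -> Rabs b <= Rabs A ->
              Rabs (a - b) <= D * Rabs A -> Rabs (c - d) <= D ->
              Rabs (a * c - b * d) <= 2 * (D * Rabs A)).
    { intros a b c d Hc Hb Hab Hcd.
      replace (a * c - b * d) with ((a - b) * c + b * (c - d)) by ring.
      eapply Rle_trans; [apply Rabs_triang |].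
      generalize (Rabs_mult_le_1 (a - b) c Hc). rewrite (Rabs_mult b).
      assert (Rabs b * Rabs (c - d) <= Rabs A * D)
        by (apply Rmult_le_compat; try apply Rabs_pos; assumption).
      lra. }
    assert (Hbox : forall a b c d : R, Rabs a <= Rabs A -> Rabs b <= Rabs A ->
              Rabs c <= 1 -> Rabs d <= 1 -> Rabs (a * c + b * d) <= 2 * Rabs A).
    { intros a b c d Ha Hb Hc Hd. eapply Rle_trans; [apply Rabs_triang |].
      generalize (Rabs_mult_le_1 a c Hc) (Rabs_mult_le_1 b d Hd). lra. }
    assert (Hbox' : forall a b c d : R, Rabs a <= Rabs A -> Rabs b <= Rabs A ->
              Rabs c <= 1 -> Rabs d <= 1 -> Rabs (a * c - b * d) <= 2 * Rabs A).
    { intros a b c d Ha Hb Hc Hd. replace (a * c - b * d) with (a * c + b * - d) by ring.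
      apply Hbox; rewrite ?Rabs_Ropp; assumption. }
    unfold tangential, transverse.
    eapply Rle_trans.
    { apply Hl; [apply Hbox | apply Hbox' | apply Hbox | apply Hbox'];
        auto using Rabs_cos_le_1, Rabs_sin_le_1. }
    rewrite Rmult_assoc. apply Rmult_le_compat_l; [assumption |].
    replace (8 * Rabs A * D) with (4 * (D * Rabs A) + 4 * (D * Rabs A)) by ring.
    assert (Hs0 : Rabs s <= Rabs s) by lra.
    apply Rplus_le_compat.
    + replace (X u s * cos (u s) + Y u s * sin (u s) - (X v s * cos (v s) + Y v s * sin (v s)))
        with ((X u s * cos (u s) - X v s * cos (v s)) + (Y u s * sin (u s) - Y v s * sin (v s)))
        by ring.
      eapply Rle_trans; [apply Rabs_triang |].
      assert (P1 := Prod _ _ _ _ (Rabs_cos_le_1 (u s)) (BX v Hv) IX (Dc s Hs0)).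
      assert (P2 := Prod _ _ _ _ (Rabs_sin_le_1 (u s)) (BY v Hv) IY (Ds s Hs0)). lra.
    + replace (Y u s * cos (u s) - X u s * sin (u s) - (Y v s * cos (v s) - X v s * sin (v s)))
        with ((Y u s * cos (u s) - Y v s * cos (v s)) + - (X u s * sin (u s) - X v s * sin (v s)))
        by ring.
      eapply Rle_trans; [apply Rabs_triang |]. rewrite Rabs_Ropp.
      assert (P1 := Prod _ _ _ _ (Rabs_cos_le_1 (u s)) (BY v Hv) IY (Dc s Hs0)).
      assert (P2 := Prod _ _ _ _ (Rabs_sin_le_1 (u s)) (BX v Hv) IX (Ds s Hs0)). lra.
  - assert (Hth := continuous_of_derivative _ _ Dth).
    exists (X th), (Y th), th. split; [| split].
    + apply (RInt_point 0 (fun r => cos (th r))).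
    + apply (RInt_point 0 (fun r => sin (th r))).
    + intros s. split; [| split]; auto.
Qed.

(** Bootstrapping: if x, y and th are of class C^k, then so are their derivatives
cos th, sin th and [kap] (tau, nu). *)
Lemma unit_speed_frame_smooth kap x y th :
  (forall k a b, Ck k a -> Ck k b -> Ck k (fun s => kap (a s) (b s))) ->
  unit_speed_frame x y th (fun s => kap (tangential x y th s) (transverse x y th s)) ->
  forall k, Ck k x /\ Ck k y /\ Ck k th.
Proof.
  intros Hkap Hfr.
  assert (Dx : forall s, is_derive x s (cos (th s))) by apply Hfr.
  assert (Dy : forall s, is_derive y s (sin (th s))) by apply Hfr.
  assert (Dth := fun s => proj2 (proj2 (Hfr s))). cbv beta in Dth.
  induction k as [|k [Hx [Hy Ht]]].
  - split; [| split].
    + exact (continuous_of_derivative _ _ Dx).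
    + exact (continuous_of_derivative _ _ Dy).
    + exact (continuous_of_derivative _ _ Dth).
  - destruct (Ck_cos_sin k th Ht) as [Hc Hs]. split; [| split].
    + exact (Ck_of_derivative k x _ Dx Hc).
    + exact (Ck_of_derivative k y _ Dy Hs).
    + apply (Ck_of_derivative k th _ Dth).
      apply Hkap; [now apply Ck_tangential | now apply Ck_transverse].
Qed.

(** The solution k of - h (k (w^2 + q^2) + q) / w^3 = Psi(p,q), where
w^2 = p^2 + h^2. *)
Definition curvature_for_H (Psi : R -> R -> R) (h p q : R) : R :=
  - ((Psi p q * (sqrt (p * p + h * h) * (p * p + h * h)) * / h + q)
     * / (p * p + q * q + h * h)).

Lemma curvature_for_H_locally_lipschitz Psi h :
  0 < h -> class_C 1 Psi -> locally_lipschitz2 (curvature_for_H Psi h).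
Proof.
  intros Hh HPsi.
  assert (Hp : locally_lipschitz2 (fun p _ => p * p + h * h)).
  { apply locally_lipschitz2_plus; [| apply locally_lipschitz2_const].
    apply locally_lipschitz2_mult; apply locally_lipschitz2_fst. }
  assert (Hpq : locally_lipschitz2 (fun p q => p * p + q * q + h * h)).
  { apply locally_lipschitz2_plus; [| apply locally_lipschitz2_const].
    apply locally_lipschitz2_plus; apply locally_lipschitz2_mult;
      (apply locally_lipschitz2_fst || apply locally_lipschitz2_snd). }
  assert (Hh2 : 0 < h * h) by nra.
  assert (Hm : locally_lipschitz2 (fun p q => -1 *
     ((Psi p q * (sqrt (p * p + h * h) * (p * p + h * h)) * / h + q) * / (p * p + q * q + h * h)))).
  { apply locally_lipschitz2_mult; [apply locally_lipschitz2_const |].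
    apply (locally_lipschitz2_mult
      (fun p q => Psi p q * (sqrt (p * p + h * h) * (p * p + h * h)) * / h + q)
      (fun p q => / (p * p + q * q + h * h))).
    - apply locally_lipschitz2_plus; [| apply locally_lipschitz2_snd].
      apply locally_lipschitz2_mult; [| apply locally_lipschitz2_const].
      apply locally_lipschitz2_mult; [now apply class_C1_locally_lipschitz2 |].
      apply (locally_lipschitz2_mult (fun p _ => sqrt (p * p + h * h))); [| assumption].
      apply (locally_lipschitz2_sqrt (fun p _ => p * p + h * h) (h * h)); [assumption | | assumption].
      intros p _. nra.
    - apply (locally_lipschitz2_inv _ (h * h)); [assumption | | assumption].
      intros p q. nra. }
  intros A. destruct (Hm A) as [L [HL Hl]]. exists L. split; [assumption |].
  intros p q p' q' H1 H2 H3 H4. generalize (Hl p q p' q' H1 H2 H3 H4).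
  unfold curvature_for_H.
  match goal with |- Rabs ?a <= _ -> Rabs ?b <= _ => replace b with a by ring end. trivial.
Qed.

Lemma Ck_curvature_for_H Psi h k a b :
  0 < h -> class_C k Psi -> Ck k a -> Ck k b ->
  Ck k (fun s => curvature_for_H Psi h (a s) (b s)).
Proof.
  intros Hh HPsi Ha Hb.
  assert (Hp : Ck k (fun s => a s * a s + h * h)).
  { apply Ck_plus; [now apply Ck_mult | apply Ck_const]. }
  unfold curvature_for_H. apply Ck_opp, Ck_mult.
  - apply Ck_plus; [| assumption]. apply Ck_mult; [| apply Ck_const].
    apply Ck_mult; [now apply Ck_comp_2d |]. apply Ck_mult; [| assumption].
    apply Ck_sqrt; [intros s; nra | assumption].
  - apply Ck_inv; [intros s; nra |].
    apply Ck_plus; [| apply Ck_const]. apply Ck_plus; now apply Ck_mult.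
Qed.

(** * Mean curvature of helicoidal surfaces *)

Lemma cos2_plus_sin2 z : cos z * cos z + sin z * sin z = 1.
Proof. generalize (sin2_cos2 z). unfold Rsqr. lra. Qed.

Lemma tangential2_plus_transverse2 x y th s :
  tangential x y th s ^ 2 + transverse x y th s ^ 2 = x s ^ 2 + y s ^ 2.
Proof.
  unfold tangential, transverse. set (c := cos (th s)). set (d := sin (th s)).
  assert (H : c * c + d * d = 1) by apply cos2_plus_sin2.
  transitivity ((x s ^ 2 + y s ^ 2) * (c * c + d * d)); [ring | rewrite H; ring].
Qed.

(** The projection of the curve to the direction of X(s) has speed at most 1, so
|X(s)| <= |s|. *)
Lemma unit_speed_distance_bound x y th k s :
  unit_speed_frame x y th k -> x 0 = 0 -> y 0 = 0 -> x s ^ 2 + y s ^ 2 <= s ^ 2.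
Proof.
  intros Hfr x0 y0.
  set (q := x s ^ 2 + y s ^ 2). set (r := sqrt q).
  assert (Hq : 0 <= q) by (unfold q; nra).
  assert (Hr : r * r = q) by now apply sqrt_sqrt.
  assert (Hr0 : 0 <= r) by apply sqrt_pos.
  assert (H : Rabs ((x s * x s + y s * y s) - (x s * x 0 + y s * y 0)) <= r * Rabs (s - 0)).
  { apply (lipschitz_of_derivative_bound (fun u => x s * x u + y s * y u)
             (fun u => x s * cos (th u) + y s * sin (th u))).
    - intros u _.
      apply (is_derive_plus (fun u => x s * x u) (fun u => y s * y u)).
      + apply (is_derive_scal x u (x s)), Hfr.
      + apply (is_derive_scal y u (y s)), Hfr.
    - intros u _. apply Rabs_le_between.
      assert (E := cos2_plus_sin2 (th u)).
      set (c := cos (th u)) in *. set (d := sin (th u)) in *.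
      (* Lagrange's identity for the vectors (x,y) and (c,d). *)
      assert (HL : (x s * c + y s * d) * (x s * c + y s * d) + (x s * d - y s * c) * (x s * d - y s * c)
                   = r * r).
      { rewrite Hr. unfold q. transitivity ((x s ^ 2 + y s ^ 2) * (c * c + d * d)); [ring | rewrite E; ring]. }
      set (z := x s * c + y s * d) in *. set (z' := x s * d - y s * c) in *. nra. }
  rewrite x0, y0, Rminus_0_r in H.
  replace (x s * x s + y s * y s - (x s * 0 + y s * 0)) with (r * r) in H
    by (rewrite Hr; unfold q; ring).
  rewrite Rabs_pos_eq in H by nra.
  assert (r <= Rabs s).
  { destruct (Rle_lt_or_eq_dec 0 r Hr0) as [Hp | Hz].
    - apply Rmult_le_reg_l with r; assumption.
    - rewrite <- Hz. apply Rabs_pos. }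
  rewrite <- Hr, <- (pow2_abs s). nra.
Qed.

Lemma frame_tangent x y th k s :
  unit_speed_frame x y th k -> tangent (fun s => (x s, y s)) s = (cos (th s), sin (th s)).
Proof.
  intros Hfr. unfold tangent, DeriveC. f_equal; apply is_derive_unique, Hfr.
Qed.

Lemma frame_normal x y th k s :
  unit_speed_frame x y th k -> normal (fun s => (x s, y s)) s = (- sin (th s), cos (th s)).
Proof.
  intros Hfr. unfold normal. rewrite (frame_tangent x y th k s Hfr).
  unfold Cmult, Ci. simpl. f_equal; ring.
Qed.

Lemma frame_tau x y th k s :
  unit_speed_frame x y th k -> tau (fun s => (x s, y s)) s = tangential x y th s.
Proof.
  intros Hfr. unfold tau. rewrite (frame_tangent x y th k s Hfr). reflexivity.
Qed.

Lemma frame_nu x y th k s :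
  unit_speed_frame x y th k -> nu (fun s => (x s, y s)) s = transverse x y th s.
Proof.
  intros Hfr. unfold nu. rewrite (frame_normal x y th k s Hfr).
  unfold dotC, transverse. simpl. ring.
Qed.

Lemma frame_arclength x y th k :
  (forall n, Ck n x) -> (forall n, Ck n y) -> unit_speed_frame x y th k ->
  arclength_curve (fun s => (x s, y s)).
Proof.
  intros Hx Hy Hfr. split.
  - split; now apply smooth1_of_Ck.
  - intros s. rewrite (frame_tangent x y th k s Hfr). unfold Cmod. simpl.
    rewrite !Rmult_1_r, cos2_plus_sin2. apply sqrt_1.
Qed.

(** The square root of the determinant of the first fundamental form, and the
factor that normalizes the normal vector. *)
Definition area_density (h : R) (x y th : R -> R) (s : R) : R :=
  sqrt (tangential x y th s ^ 2 + h ^ 2).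

Section Helicoidal.
Variables (h : R) (x y th k : R -> R).
Hypothesis h_pos : 0 < h.
Hypothesis frame : unit_speed_frame x y th k.

Let F := helicoidal_surface h (fun s => (x s, y s)).

Lemma frame_x s : is_derive x s (cos (th s)).
Proof. apply frame. Qed.
Lemma frame_y s : is_derive y s (sin (th s)).
Proof. apply frame. Qed.
Lemma frame_th s : is_derive th s (k s).
Proof. apply frame. Qed.

Lemma Derive_x s : Derive (fun u => x u) s = cos (th s).
Proof. apply is_derive_unique, frame_x. Qed.
Lemma Derive_y s : Derive (fun u => y u) s = sin (th s).
Proof. apply is_derive_unique, frame_y. Qed.
Lemma Derive_th s : Derive (fun u => th u) s = k s.
Proof. apply is_derive_unique, frame_th. Qed.

Ltac ex_derive_frame :=
  repeat match goal with
  | |- _ /\ _ => split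
  | |- True => exact I
  | |- ex_derive ?g ?p =>
      first [ unify g x; exact (ex_intro _ _ (frame_x p))
            | unify g y; exact (ex_intro _ _ (frame_y p))
            | unify g th; exact (ex_intro _ _ (frame_th p)) ]
  end.

Ltac derive_frame :=
  apply is_derive_unique; auto_derive;
  [ ex_derive_frame
  | rewrite ?Derive_x, ?Derive_y; ring ].

Lemma helicoidal_d_s s t : d_s F s t = ((cos (t + th s), sin (t + th s)), 0).
Proof.
  unfold d_s, Derive3, DeriveC, F, helicoidal_surface, expi, Cmult. simpl.
  rewrite cos_plus, sin_plus. repeat apply f_equal2; derive_frame.
Qed.

Lemma helicoidal_d_t s t :
  d_t F s t =
  ((- transverse x y th s * cos (t + th s) - tangential x y th s * sin (t + th s),
    - transverse x y th s * sin (t + th s) + tangential x y th s * cos (t + th s)), h).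
Proof.
  unfold d_t, Derive3, DeriveC, F, helicoidal_surface, expi, Cmult. simpl.
  assert (E := cos2_plus_sin2 (th s)).
  rewrite cos_plus, sin_plus. unfold tangential, transverse.
  repeat apply f_equal2; apply is_derive_unique; auto_derive; trivial.
  - transitivity ((- sin t * x s - cos t * y s) * (cos (th s) * cos (th s) + sin (th s) * sin (th s)));
      [rewrite E |]; ring.
  - transitivity ((- sin t * y s + cos t * x s) * (cos (th s) * cos (th s) + sin (th s) * sin (th s)));
      [rewrite E |]; ring.
  - ring.
Qed.

Lemma helicoidal_g_ss s t : g_ss F s t = 1.
Proof.
  unfold g_ss. rewrite helicoidal_d_s. unfold dot3, dotC. simpl.
  rewrite cos2_plus_sin2. ring.
Qed.

Lemma helicoidal_g_st s t : g_st F s t = - transverse x y th s.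
Proof.
  unfold g_st. rewrite helicoidal_d_s, helicoidal_d_t. unfold dot3, dotC. simpl.
  transitivity (- transverse x y th s *
    (cos (t + th s) * cos (t + th s) + sin (t + th s) * sin (t + th s)));
    [ring | rewrite cos2_plus_sin2; ring].
Qed.

Lemma helicoidal_g_tt s t :
  g_tt F s t = tangential x y th s ^ 2 + transverse x y th s ^ 2 + h ^ 2.
Proof.
  unfold g_tt. rewrite helicoidal_d_t. unfold dot3, dotC. simpl.
  transitivity ((tangential x y th s ^ 2 + transverse x y th s ^ 2) *
    (cos (t + th s) * cos (t + th s) + sin (t + th s) * sin (t + th s)) + h ^ 2);
    [ring | rewrite cos2_plus_sin2; ring].
Qed.

(** The vector d_s F is a horizontal unit vector, and d_t F has vertical component h. *)
Lemma helicoidal_immersion :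
  (forall n, Ck n x) -> (forall n, Ck n y) -> immersion F.
Proof.
  intros Hx Hy.
  assert (Hid : forall n, Ck n (fun t => t)).
  { intros [|n].
    - intros t. apply continuous_id.
    - apply Ck_of_derivative with (fun _ => 1); [| apply Ck_const].
      intros s. apply (is_derive_id (K := R_AbsRing)). }
  split.
  - assert (Hc : forall n, Ck n cos) by (intros n; exact (proj1 (Ck_cos_sin n _ (Hid n)))).
    assert (Hs : forall n, Ck n sin) by (intros n; exact (proj2 (Ck_cos_sin n _ (Hid n)))).
    split; [| split]; intros n.
    + replace (fun s t => Re (fst (F s t))) with (fun s t => x s * cos t + (- y s) * sin t).
      * apply class_C_plus; apply class_C_mult_separate; auto. now apply Ck_opp.
      * do 2 (apply functional_extensionality; intro). unfold F. simpl. ring.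
    + replace (fun s t => Im (fst (F s t))) with (fun s t => y s * cos t + x s * sin t).
      * apply class_C_plus; apply class_C_mult_separate; auto.
      * do 2 (apply functional_extensionality; intro). unfold F. simpl. ring.
    + apply (class_C_mult_separate n (fun _ => h) (fun t => t)); [apply Ck_const | apply Hid].
  - intros s t a b. rewrite helicoidal_d_s, helicoidal_d_t. unfold lincomb, RtoC, Cplus, Cmult. simpl.
    intros E. injection E as E1 E2 E3.
    assert (Hb : b = 0) by nra. split; [| assumption]. subst b.
    assert (E1' : a * cos (t + th s) = 0) by lra.
    assert (E2' : a * sin (t + th s) = 0) by lra.
    generalize (cos2_plus_sin2 (t + th s)). intros E.
    apply Rmult_integral in E1'. apply Rmult_integral in E2'.
    destruct E1' as [? | E1']; [assumption |]. destruct E2' as [? | E2']; [assumption |].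
    rewrite E1', E2' in E. lra.
Qed.

Let w := area_density h x y th.

Lemma area_density_sqr s : w s * w s = tangential x y th s ^ 2 + h ^ 2.
Proof. apply sqrt_sqrt. nra. Qed.

Lemma area_density_pos s : 0 < w s.
Proof. apply sqrt_lt_R0. nra. Qed.

(** The point moves along the tangent with speed 1, and the tangent turns towards the
normal at rate k. *)
Lemma is_derive_tangential s :
  is_derive (tangential x y th) s (1 + k s * transverse x y th s).
Proof.
  unfold tangential, transverse. auto_derive.
  - ex_derive_frame.
  - rewrite Derive_x, Derive_y, Derive_th, !Rmult_1_l.
    rewrite <- (cos2_plus_sin2 (th s)). ring.
Qed.

Lemma Derive_tangential s :
  Derive (fun u => tangential x y th u) s = 1 + k s * transverse x y th s.
Proof. apply is_derive_unique, is_derive_tangential. Qed.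

Let w' s := tangential x y th s * (1 + k s * transverse x y th s) / w s.

Lemma is_derive_area_density s : is_derive w s (w' s).
Proof.
  unfold w'.
  replace (tangential x y th s * (1 + k s * transverse x y th s) / w s)
    with (2 * tangential x y th s * (1 + k s * transverse x y th s) / (2 * w s))
    by (generalize (area_density_pos s); intros; field; lra).
  apply (is_derive_sqrt (fun s => tangential x y th s ^ 2 + h ^ 2)); [| nra]. auto_derive.
  - eexists. apply is_derive_tangential.
  - rewrite Derive_tangential. ring.
Qed.

Lemma helicoidal_unit_normal :
  unit_normal h (fun s => (x s, y s)) =
  fun s t => ((- (h / w s) * sin (t + th s), h / w s * cos (t + th s)),
              - tangential x y th s / w s).
Proof.
  apply functional_extensionality; intro s. apply functional_extensionality; intro t.
  unfold unit_normal, w, area_density. rewrite (frame_tau x y th k s frame), (frame_normal x y th k s frame).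
  unfold expi, RtoC, Cmult. simpl. rewrite cos_plus, sin_plus.
  repeat apply f_equal2; ring.
Qed.

Let n := unit_normal h (fun s => (x s, y s)).

Lemma unit_normal_d_s s t :
  d_s n s t =
  ((h * w' s / w s ^ 2 * sin (t + th s) - h / w s * k s * cos (t + th s),
    - (h * w' s / w s ^ 2) * cos (t + th s) - h / w s * k s * sin (t + th s)),
   - (1 + k s * transverse x y th s) / w s + tangential x y th s * w' s / w s ^ 2).
Proof.
  unfold d_s, Derive3, DeriveC, n. rewrite helicoidal_unit_normal. simpl.
  assert (Hw := area_density_pos s).
  assert (Hw' := is_derive_area_density s).
  assert (Dw : Derive (fun u => w u) s = w' s) by now apply is_derive_unique.
  assert (Ht := is_derive_tangential s).
  repeat apply f_equal2; apply is_derive_unique; auto_derive;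
  ex_derive_frame; try (eexists; eassumption); try lra;
  rewrite ?Derive_th, ?Dw, ?Derive_tangential; field; lra.
Qed.

Lemma unit_normal_d_t s t :
  d_t n s t =
  ((- (h / w s) * cos (t + th s), - (h / w s) * sin (t + th s)), 0).
Proof.
  unfold d_t, Derive3, DeriveC, n. rewrite helicoidal_unit_normal. simpl.
  repeat apply f_equal2; apply is_derive_unique; auto_derive; trivial; ring.
Qed.

(** The formula is independent of t because the surface is invariant under
helicoidal motions: in the frame rotated by t + theta all inner products have
coefficients that depend on s alone. *)
Lemma helicoidal_mean_curvature s t :
  mean_curvature h (fun s => (x s, y s)) s t =
  - h * (k s * (w s ^ 2 + transverse x y th s ^ 2) + transverse x y th s) / w s ^ 3.
Proof.
  assert (Hw := area_density_pos s). assert (Hw2 := area_density_sqr s).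
  unfold mean_curvature, surface_div.
  fold F. fold n.
  rewrite helicoidal_g_ss, helicoidal_g_st, helicoidal_g_tt.
  rewrite helicoidal_d_s, helicoidal_d_t, unit_normal_d_s, unit_normal_d_t.
  unfold dot3, dotC, Re, Im. cbn [fst snd].
  assert (E := cos2_plus_sin2 (t + th s)).
  unfold w'.
  set (ta := tangential x y th s) in *. set (v := transverse x y th s) in *.
  set (c := cos (t + th s)) in *. set (d := sin (t + th s)) in *.
  set (W := w s) in *. set (K := k s).
  set (W1 := ta * (1 + K * v) / W).
  replace ((h * W1 / W ^ 2 * d - h / W * K * c) * c + (- (h * W1 / W ^ 2) * c - h / W * K * d) * d)
    with (- (h / W * K) * (c * c + d * d)) by ring.
  replace ((h * W1 / W ^ 2 * d - h / W * K * c) * (- v * c - ta * d)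
           + (- (h * W1 / W ^ 2) * c - h / W * K * d) * (- v * d + ta * c))
    with ((h / W * K * v - h * W1 / W ^ 2 * ta) * (c * c + d * d)) by ring.
  replace (- (h / W) * c * c + - (h / W) * d * d) with (- (h / W) * (c * c + d * d)) by ring.
  replace (- (h / W) * c * (- v * c - ta * d) + - (h / W) * d * (- v * d + ta * c))
    with (h / W * v * (c * c + d * d)) by ring.
  rewrite E. unfold W1.
  replace (h ^ 2) with (W * W - ta ^ 2) by (rewrite Hw2; ring).
  field. nra.
Qed.
End Helicoidal.

(** * Completeness of helicoidal surfaces *)

Lemma Rabs_le_sqrt z q : z ^ 2 <= q -> Rabs z <= sqrt q.
Proof.
  intros H. rewrite <- sqrt_Rsqr_abs. apply sqrt_le_1_alt. unfold Rsqr. lra.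
Qed.

Section Completeness.
Variables (h : R) (x y th k : R -> R).
Hypothesis h_pos : 0 < h.
Hypothesis frame : unit_speed_frame x y th k.
Hypothesis near_axis : forall s, x s ^ 2 + y s ^ 2 <= s ^ 2.

Let F := helicoidal_surface h (fun s => (x s, y s)).

(** The first fundamental form evaluated on the velocity of the path (a,b). *)
Definition speed2 (a b : R -> R) (u : R) : R :=
  Derive a u ^ 2 - 2 * transverse x y th (a u) * Derive a u * Derive b u
  + (tangential x y th (a u) ^ 2 + transverse x y th (a u) ^ 2 + h ^ 2) * Derive b u ^ 2.

Lemma path_length_speed2 a b :
  path_length F a b = RInt (fun u => sqrt (speed2 a b u)) 0 1.
Proof.
  apply RInt_ext. intros u _. f_equal. unfold F.
  rewrite (helicoidal_g_ss h x y th k frame), (helicoidal_g_st h x y th k frame),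
    (helicoidal_g_tt h x y th).
  unfold speed2. ring.
Qed.

Lemma continuous_sqrt_speed2 a b :
  Defs.C1_fun a -> Defs.C1_fun b -> forall u, continuous (fun u => sqrt (speed2 a b u)) u.
Proof.
  intros Ha Hb u. apply (continuous_comp (speed2 a b) sqrt); [| apply continuous_sqrt].
  revert u.
  assert (Hx := continuous_of_derivative x _ (fun s => proj1 (frame s))).
  assert (Hy := continuous_of_derivative y _ (fun s => proj1 (proj2 (frame s)))).
  assert (Hth := continuous_of_derivative th _ (fun s => proj2 (proj2 (frame s)))).
  assert (Hta := Ck_tangential 0 x y th Hx Hy Hth).
  assert (Htr := Ck_transverse 0 x y th Hx Hy Hth).
  assert (Ca : Ck 0 a) by (intros u; apply (ex_derive_continuous a), Ha).
  assert (Ta : Ck 0 (fun u => tangential x y th (a u)))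
    by (intros u; apply (continuous_comp a (tangential x y th)); [apply Ca | apply Hta]).
  assert (Na : Ck 0 (fun u => transverse x y th (a u)))
    by (intros u; apply (continuous_comp a (transverse x y th)); [apply Ca | apply Htr]).
  assert (Da : Ck 0 (Derive a)) by (intros u; apply Ha).
  assert (Db : Ck 0 (Derive b)) by (intros u; apply Hb).
  assert (Sq : forall g, Ck 0 g -> Ck 0 (fun u => g u ^ 2)).
  { intros g Hg. replace (fun u => g u ^ 2) with (fun u => g u * g u).
    - now apply Ck_mult.
    - apply functional_extensionality. intros u. ring. }
  change (Ck 0 (speed2 a b)). unfold speed2.
  apply Ck_plus.
  - apply Ck_plus; [now apply Sq |].
    apply Ck_opp. repeat apply Ck_mult; auto. apply Ck_const.
  - apply Ck_mult; [| now apply Sq].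
    apply Ck_plus; [| apply Ck_const]. apply Ck_plus; now apply Sq.
Qed.

Lemma tangential2_plus_transverse2_le s :
  tangential x y th s ^ 2 + transverse x y th s ^ 2 <= s ^ 2.
Proof. rewrite tangential2_plus_transverse2. apply near_axis. Qed.

(** The length of the path up to time u is a primitive of the majorant sqrt (speed2)
of |g|, so [dominated_increment] applies. *)
Lemma increment_le_path_length a b (G : R -> R -> R) (g : R -> R) :
  Defs.C1_fun a -> Defs.C1_fun b ->
  (forall u, is_derive (fun u => G (a u) (b u)) u (g u)) ->
  (forall u, g u ^ 2 <= speed2 a b u) ->
  Rabs (G (a 1) (b 1) - G (a 0) (b 0)) <= path_length F a b.
Proof.
  intros Ha Hb HG Hg. rewrite path_length_speed2.
  assert (Hc := continuous_sqrt_speed2 a b Ha Hb).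
  assert (H : Rabs (G (a 1) (b 1) - G (a 0) (b 0))
              <= RInt (fun u => sqrt (speed2 a b u)) 0 1 - RInt (fun u => sqrt (speed2 a b u)) 0 0).
  { apply (dominated_increment (fun u => G (a u) (b u))
             (fun z => RInt (fun u => sqrt (speed2 a b u)) 0 z) g
             (fun u => sqrt (speed2 a b u))); [lra | | |].
    - intros u _. apply HG.
    - intros u _. apply (is_derive_RInt_continuous (fun u => sqrt (speed2 a b u))), Hc.
    - intros u _. apply Rabs_le_sqrt, Hg. }
  rewrite (RInt_point (V := R_CompleteNormedModule) 0) in H.
  change (@zero R_CompleteNormedModule) with 0 in H. lra.
Qed.

(** By the Cauchy-Schwarz inequality the metric dominates
(tau^2 + h^2) / (tau^2 + nu^2 + h^2) ds^2.  As tau^2 + nu^2 <= s^2 this is at least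
ds^2 / ((s/h)^2 + 1), whose length function h arcsinh(s/h) is unbounded on both
sides: this is why points at infinite s lie at infinite distance. *)
Definition radial_coordinate (s : R) : R := h * arcsinh (s / h).

Lemma is_derive_radial_coordinate s :
  is_derive radial_coordinate s (/ sqrt ((s / h) ^ 2 + 1)).
Proof.
  unfold radial_coordinate.
  replace (/ sqrt ((s / h) ^ 2 + 1)) with (h * (/ h * / sqrt ((s / h) ^ 2 + 1))).
  - apply (is_derive_scal (fun s => arcsinh (s / h)) s h).
    apply (is_derive_comp arcsinh (fun s => s / h)).
    + apply is_derive_Reals, derivable_pt_lim_arcsinh.
    + auto_derive; [trivial | field; lra].
  - rewrite <- Rmult_assoc, Rinv_r, Rmult_1_l by lra. reflexivity.
Qed.

Lemma radial_increment_le_path_length a b :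
  Defs.C1_fun a -> Defs.C1_fun b ->
  Rabs (radial_coordinate (a 1) - radial_coordinate (a 0)) <= path_length F a b.
Proof.
  intros Ha Hb.
  apply (increment_le_path_length a b (fun s _ => radial_coordinate s)
           (fun u => Derive a u * / sqrt ((a u / h) ^ 2 + 1))); auto.
  - intros u. apply (is_derive_comp radial_coordinate a); [apply is_derive_radial_coordinate |].
    apply Derive_correct, Ha.
  - intros u. set (e := a u / h). set (p := Derive a u).
    assert (He : 0 < e ^ 2 + 1) by nra.
    rewrite Rpow_mult_distr, pow_inv, pow2_sqrt by lra.
    apply Rmult_le_reg_r with (e ^ 2 + 1); [assumption |].
    rewrite Rmult_assoc, Rinv_l, Rmult_1_r by lra.
    assert (Hd := tangential2_plus_transverse2_le (a u)).
    unfold speed2. fold p. set (q := Derive b u).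
    set (m := tangential x y th (a u)) in *. set (v := transverse x y th (a u)) in *.
    set (Q := p ^ 2 - 2 * v * p * q + (m ^ 2 + v ^ 2 + h ^ 2) * q ^ 2).
    assert (HQ : 0 <= Q).
    { unfold Q. replace (p ^ 2 - 2 * v * p * q + (m ^ 2 + v ^ 2 + h ^ 2) * q ^ 2)
        with ((p - v * q) ^ 2 + (m ^ 2 + h ^ 2) * q ^ 2) by ring.
      apply Rplus_le_le_0_compat; [apply pow2_ge_0 |].
      apply Rmult_le_pos; [nra | apply pow2_ge_0]. }
    (* Cauchy-Schwarz for p = (p - v q) + v q; the defect is a perfect square. *)
    assert (CS : (m ^ 2 + h ^ 2) * p ^ 2 <= Q * (m ^ 2 + v ^ 2 + h ^ 2)).
    { assert (I : Q * (m ^ 2 + v ^ 2 + h ^ 2) - (m ^ 2 + h ^ 2) * p ^ 2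
                  = (v * p - (m ^ 2 + v ^ 2 + h ^ 2) * q) ^ 2) by (unfold Q; ring).
      generalize (pow2_ge_0 (v * p - (m ^ 2 + v ^ 2 + h ^ 2) * q)). lra. }
    assert (Hh2 : 0 < h ^ 2) by nra.
    apply Rmult_le_reg_l with (h ^ 2); [assumption |].
    replace (h ^ 2 * (Q * (e ^ 2 + 1))) with (Q * (a u ^ 2 + h ^ 2)) by (unfold e; field; lra).
    assert (Q * (m ^ 2 + v ^ 2 + h ^ 2) <= Q * (a u ^ 2 + h ^ 2))
      by (apply Rmult_le_compat_l; lra).
    assert (0 <= m ^ 2 * p ^ 2) by (apply Rmult_le_pos; apply pow2_ge_0).
    lra.
Qed.

Lemma vertical_increment_le_path_length a b :
  Defs.C1_fun a -> Defs.C1_fun b -> Rabs (h * b 1 - h * b 0) <= path_length F a b.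
Proof.
  intros Ha Hb.
  apply (increment_le_path_length a b (fun _ t => h * t) (fun u => h * Derive b u)); auto.
  - intros u. apply (is_derive_scal b u h). apply Derive_correct, Hb.
  - intros u. unfold speed2. set (p := Derive a u). set (q := Derive b u).
    set (m := tangential x y th (a u)). set (v := transverse x y th (a u)).
    assert (0 <= (p - v * q) ^ 2) by apply pow2_ge_0.
    assert (0 <= (m * q) ^ 2) by apply pow2_ge_0.
    lra.
Qed.

Lemma intrinsic_dist_lower_bound p q m :
  (forall a b, Defs.C1_fun a -> Defs.C1_fun b -> (a 0, b 0) = p -> (a 1, b 1) = q ->
     m <= path_length F a b) ->
  Rbar_le m (intrinsic_dist F p q).
Proof.
  intros H. apply (proj2 (Glb_Rbar_correct (path_lengths F p q))).
  intros l (a & b & Ha & Hb & H0 & H1 & ->). now apply H.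
Qed.

Lemma radial_increment_le_dist p q :
  Rbar_le (Rabs (radial_coordinate (fst q) - radial_coordinate (fst p))) (intrinsic_dist F p q).
Proof.
  apply intrinsic_dist_lower_bound. intros a b Ha Hb <- <-. simpl.
  now apply radial_increment_le_path_length.
Qed.

Lemma vertical_increment_le_dist p q :
  Rbar_le (Rabs (h * snd q - h * snd p)) (intrinsic_dist F p q).
Proof.
  apply intrinsic_dist_lower_bound. intros a b Ha Hb <- <-. simpl.
  now apply vertical_increment_le_path_length.
Qed.

Lemma C1_affine c d : Defs.C1_fun (fun u => c + u * d).
Proof.
  assert (D : forall u, is_derive (fun u => c + u * d) u d)
    by (intros u; auto_derive; [trivial | ring]).
  intros u. split; [now exists d |].
  apply (continuous_ext (fun _ => d)); [| apply continuous_const].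
  intros v. symmetry. now apply is_derive_unique.
Qed.

(** The bound is that of the length of the straight segment in the parameter plane,
on which |nu| and |X| do not exceed |s| <= |fst p| + |fst q|. *)
Lemma intrinsic_dist_upper_bound p q :
  Rbar_le (intrinsic_dist F p q)
    (Rabs (fst q - fst p) + (Rabs (fst p) + Rabs (fst q) + h) * Rabs (snd q - snd p)).
Proof.
  set (a := fun u => fst p + u * (fst q - fst p)).
  set (b := fun u => snd p + u * (snd q - snd p)).
  assert (Ha : Defs.C1_fun a) by apply C1_affine. assert (Hb : Defs.C1_fun b) by apply C1_affine.
  apply Rbar_le_trans with (Finite (path_length F a b)).
  - apply (proj1 (Glb_Rbar_correct (path_lengths F p q))).
    exists a, b. split; [exact Ha | split; [exact Hb | split; [| split; [| reflexivity]]]].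
    + unfold a, b. rewrite !Rmult_0_l, !Rplus_0_r. now destruct p.
    + unfold a, b. rewrite !Rmult_1_l. destruct q. f_equal; simpl; ring.
  - simpl. rewrite path_length_speed2.
    eapply Rle_trans; [apply Rle_abs |].
    rewrite <- (Rmult_1_l (Rabs (fst q - fst p) + _)). rewrite <- (Rminus_0_r 1) at 2.
    apply abs_RInt_le_const; [lra | |].
    { apply (ex_RInt_continuous (V := R_CompleteNormedModule)).
      intros z _. now apply continuous_sqrt_speed2. }
    intros u Hu. rewrite Rabs_pos_eq by apply sqrt_pos.
    set (M := Rabs (fst q - fst p) + (Rabs (fst p) + Rabs (fst q) + h) * Rabs (snd q - snd p)).
    assert (P1 := Rabs_pos (fst p)). assert (P2 := Rabs_pos (fst q)).
    assert (P3 := Rabs_pos (fst q - fst p)). assert (P4 := Rabs_pos (snd q - snd p)).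
    assert (HM : 0 <= M) by (unfold M; nra).
    rewrite <- (sqrt_Rsqr M HM). apply sqrt_le_1_alt. unfold Rsqr, speed2.
    replace (Derive a u) with (fst q - fst p)
      by (symmetry; apply is_derive_unique; unfold a; auto_derive; [trivial | ring]).
    replace (Derive b u) with (snd q - snd p)
      by (symmetry; apply is_derive_unique; unfold b; auto_derive; [trivial | ring]).
    assert (Hau : Rabs (a u) <= Rabs (fst p) + Rabs (fst q)).
    { unfold a. replace (fst p + u * (fst q - fst p)) with ((1 - u) * fst p + u * fst q) by ring.
      eapply Rle_trans; [apply Rabs_triang |]. rewrite !Rabs_mult.
      rewrite (Rabs_pos_eq (1 - u)), (Rabs_pos_eq u) by lra. nra. }
    assert (Hd := tangential2_plus_transverse2_le (a u)).
    assert (Hv : Rabs (transverse x y th (a u)) <= Rabs (a u)).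
    { apply Rsqr_le_abs_0. unfold Rsqr. nra. }
    unfold M. clear M HM. revert Hd Hv.
    set (m := tangential x y th (a u)). set (v := transverse x y th (a u)).
    set (P := fst q - fst p) in *. set (Q := snd q - snd p) in *.
    set (N := Rabs (fst p) + Rabs (fst q)) in *. intros Hd Hv.
    assert (HN : 0 <= Rabs (a u)) by apply Rabs_pos.
    assert (Hmv : m ^ 2 + v ^ 2 <= N ^ 2).
    { rewrite <- (pow2_abs (a u)) in Hd. nra. }
    assert (Hcross : - (v * P * Q) <= N * (Rabs P * Rabs Q)).
    { eapply Rle_trans; [apply Rle_abs |]. rewrite Rabs_Ropp, !Rabs_mult, Rmult_assoc.
      apply Rmult_le_compat_r; [nra | lra]. }
    rewrite <- (pow2_abs P), <- (pow2_abs Q).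
    assert (HQ2 := pow2_ge_0 (Rabs Q)).
    assert (HPQ : 0 <= Rabs P * Rabs Q) by now apply Rmult_le_pos.
    assert ((m ^ 2 + v ^ 2 + h ^ 2) * Rabs Q ^ 2 <= (N + h) ^ 2 * Rabs Q ^ 2).
    { apply Rmult_le_compat_r; [assumption |]. assert (0 <= N * h) by (unfold N; nra). nra. }
    assert (0 <= h * (Rabs P * Rabs Q)) by (apply Rmult_le_pos; lra).
    lra.
Qed.

(** The coordinates h arcsinh(s/h) and h t are 1-Lipschitz for the intrinsic distance,
so both converge along a Cauchy sequence; as they are invertible with continuous
inverse, s and t converge too. *)
Lemma helicoidal_complete : complete_surface F.
Proof.
  intros p Hp.
  assert (Cauchy : forall v : R * R -> R,
            (forall p q, Rbar_le (Rabs (v q - v p)) (intrinsic_dist F p q)) ->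
            exists l : R, is_lim_seq (fun n => v (p n)) l).
  { intros v Hv.
    assert (Hc : ex_finite_lim_seq (fun n => v (p n))).
    { apply ex_lim_seq_cauchy_corr. intros eps. destruct (Hp eps) as [N HN].
      exists N. intros m n Hm Hn. 
      exact (Rbar_le_lt_trans _ _ _ (Hv (p n) (p m)) (HN n m Hn Hm)). }
    exact Hc. }
  destruct (Cauchy (fun q => radial_coordinate (fst q)) radial_increment_le_dist) as [S HS].
  destruct (Cauchy (fun q => h * snd q) vertical_increment_le_dist) as [T HT].
  (* The inverse of the two coordinates, applied to their limits. *)
  set (s := h * sinh (/ h * S)). set (t := / h * T).
  assert (Ls : is_lim_seq (fun n => fst (p n)) s).
  { apply is_lim_seq_ext with (fun n => h * sinh (/ h * radial_coordinate (fst (p n)))).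
    - intros n. unfold radial_coordinate. rewrite <- Rmult_assoc, Rinv_l, Rmult_1_l by lra.
      rewrite sinh_arcsinh. field. lra.
    - apply (is_lim_seq_continuous (fun z => h * sinh (/ h * z))); [| exact HS].
      apply derivable_continuous_pt. exists (h * (/ h * cosh (/ h * S))).
      apply is_derive_Reals. apply (is_derive_scal (fun z => sinh (/ h * z)) S h).
      apply (is_derive_comp sinh (fun z => / h * z)).
      + apply is_derive_Reals, derivable_pt_lim_sinh.
      + auto_derive; [trivial | ring]. }
  assert (Lt : is_lim_seq (fun n => snd (p n)) t).
  { apply is_lim_seq_ext with (fun n => / h * (h * snd (p n))).
    - intros n. field. lra.
    - apply (is_lim_seq_scal_l _ (/ h) T HT). }
  exists (s, t).
  assert (Lz : is_lim_seq
    (fun n => Rabs (s - fst (p n)) + (Rabs (fst (p n)) + Rabs s + h) * Rabs (t - snd (p n))) 0).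
  { replace (Finite 0) with (Finite (Rabs (s - s) + (Rabs s + Rabs s + h) * Rabs (t - t)))
      by (rewrite !Rminus_diag, Rabs_R0; f_equal; ring).
    apply is_lim_seq_plus'; [| apply is_lim_seq_mult'; [apply is_lim_seq_plus'; [apply is_lim_seq_plus' |] |]];
      try apply is_lim_seq_const.
    - apply (is_lim_seq_abs _ (Finite (s - s))), is_lim_seq_minus'; [apply is_lim_seq_const | assumption].
    - now apply (is_lim_seq_abs _ (Finite s)).
    - apply (is_lim_seq_abs _ (Finite (t - t))), is_lim_seq_minus'; [apply is_lim_seq_const | assumption]. }
  intros eps. apply is_lim_seq_spec in Lz. destruct (Lz eps) as [N HN].
  exists N. intros n Hn.
  eapply Rbar_le_lt_trans; [apply intrinsic_dist_upper_bound |].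
  specialize (HN n Hn). rewrite Rminus_0_r in HN. apply Rabs_lt_between in HN. apply HN.
Qed.
End Completeness.

(** * Existence of complete helicoidal surfaces *)

Theorem theorem3p1 :
  forall (Psi : R -> R -> R) (h : R),
    smooth2 Psi -> 0 < h ->
    exists X : R -> C,
      arclength_curve X
      /\ immersion (helicoidal_surface h X)
      /\ complete_surface (helicoidal_surface h X)
      /\ forall s t : R, mean_curvature h X s t = Psi (tau X s) (nu X s).
Proof.
  intros Psi h HPsi Hh.
  destruct (unit_speed_curve_with_prescribed_curvature (curvature_for_H Psi h))
    as (x & y & th & x0 & y0 & Hfr).
  { apply curvature_for_H_locally_lipschitz; [assumption | apply HPsi]. }
  assert (Hsm : forall n, Ck n x /\ Ck n y /\ Ck n th).
  { apply (unit_speed_frame_smooth (curvature_for_H Psi h)); [| assumption].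
    intros n a b. apply Ck_curvature_for_H; [assumption | apply HPsi]. }
  assert (Hx : forall n, Ck n x) by apply Hsm.
  assert (Hy : forall n, Ck n y) by apply Hsm.
  exists (fun s => (x s, y s)). split; [| split; [| split]].
  - exact (frame_arclength x y th _ Hx Hy Hfr).
  - exact (helicoidal_immersion h x y th _ Hh Hfr Hx Hy).
  - apply (helicoidal_complete h x y th _ Hh Hfr).
    intros s. exact (unit_speed_distance_bound x y th _ s Hfr x0 y0).
  - intros s t.
    rewrite (helicoidal_mean_curvature h x y th _ Hh Hfr), (frame_tau _ _ _ _ _ Hfr),
      (frame_nu _ _ _ _ _ Hfr).
    assert (W2 := area_density_sqr h x y th s). assert (W0 := area_density_pos h x y th Hh s).
    unfold area_density in *.
    set (p := tangential x y th s) in *. set (q := transverse x y th s) in *.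
    unfold curvature_for_H.
    replace (p * p + h * h) with (p ^ 2 + h ^ 2) by ring.
    set (w := sqrt (p ^ 2 + h ^ 2)) in *.
    replace (p * p + q * q + h * h) with (w * w + q * q) by (rewrite W2; ring).
    rewrite <- W2. field. nra.
Qed.
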